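(* Let $\mathfrak{g}$ and $V$ be two vector spaces over $\mathbf{k}$. There is an $L_\infty$-algebra structure on the graded vector space $L'[1]\oplus\mathfrak{a}$ with structure maps $$l_2(q[1],q'[1])=(-1)^{|q|}[q,q']_\mathsf{B}[1],\qquad l_k(q[1],a_1,\ldots,a_{k-1})=P[\cdots[[q,a_1]_\mathsf{B},a_2]_\mathsf{B},\ldots,a_{k-1}]_\mathsf{B}\quad(k\ge2),$$ for homogeneous elements $q,q'\in L'$ and $a_1,\ldots,a_{k-1}\in\mathfrak{a}$, where, up to permutations of the entries $q[1],q'[1]$ of $l_2$ and of the entries $q[1],a_1,\ldots,a_{k-1}$ of $l_k$, all other structure maps vanish.
   Context: $\mathbf{k}$ is a field of characteristic $0$; vector spaces, linear maps and tensor products are over $\mathbf{k}$. Balavoine bracket: for a vector space $E$, let $C^n(E,E)=\mathrm{Hom}(E^{\otimes n},E)$, and let $C^{\bullet+1}(E,E)=\oplus_{n\ge 0}C^{n+1}(E,E)$ with $C^{n+1}(E,E)$ in degree $n$. It is a graded Lie algebra with the degree $0$ bracket $[f,g]_\mathsf{B} = f\diamond g-(-1)^{mn}g\diamond f$ for $f\in C^{m+1}(E,E)$, $g\in C^{n+1}(E,E)$, where $$(f\diamond g)(x_1,\ldots,x_{m+n+1}) = \sum_{i=1}^{m+1}(-1)^{(i-1)n}\sum_{\sigma\in Sh(i-1,n)}(-1)^\sigma f(x_{\sigma(1)},\ldots,x_{\sigma(i-1)},g(x_{\sigma(i)},\ldots,x_{\sigma(i+n-1)},x_{i+n}),x_{i+n+1},\ldots,x_{m+n+1}),$$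 $(-1)^\sigma$ is the sign of $\sigma$, and $Sh(i,j)$ is the set of $\sigma\in S_{i+j}$ with $\sigma(1)<\cdots<\sigma(i)$ and $\sigma(i+1)<\cdots<\sigma(i+j)$. Bidegree: let $\mathfrak{g}^{k,l}\subset(\mathfrak{g}\oplus V)^{\otimes k+l}$ be the direct sum of all tensor products of $k$ copies of $\mathfrak{g}$ and $l$ copies of $V$ in all orders (zero if $k<0$ or $l<0$). For $k,l\ge -1$ with $k+l=n\geq 0$, $C^{k|l}(\mathfrak{g}\oplus V,\mathfrak{g}\oplus V)$ is the space of $f\in\mathrm{Hom}((\mathfrak{g}\oplus V)^{\otimes n+1},\mathfrak{g}\oplus V)$ with $f(\mathfrak{g}^{k+1,l})\subset\mathfrak{g}$, $f(\mathfrak{g}^{k,l+1})\subset V$ and $f=0$ on the other summands. Let $L=(C^{\bullet+1}(\mathfrak{g}\oplus V,\mathfrak{g}\oplus V),[~,~]_\mathsf{B})$, $L'=\oplus_{k\ge0}C^{k|0}(\mathfrak{g}\oplus V,\mathfrak{g}\oplus V)$ ($C^{k|0}$ in degree $k$; a graded Lie subalgebra), $\mathfrak{a}=\oplus_{l\ge 0}C^{-1|l+1}(\mathfrak{g}\oplus V,\mathfrak{g}\oplus V)$ ($C^{-1|l+1}$ in degree $l$; an abelian subalgebra), and let $P:L\to L$ be the projection onto $\mathfrak{a}$ that vanishes on all $C^{k|l}$ with $k\ge 0$. The graded space $L'[1]\oplus\mathfrak{a}$ has $(L'[1]\oplus\mathfrak{a})_i=L'_{i+1}\oplus\mathfrak{a}_i$;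 write $x[1]$ for $x\in L'$ viewed in $L'[1]$; $|q|$ is the degree of $q$ in $L'$. An $L_\infty$-algebra (degree-shifted convention) is a graded vector space $\mathfrak{L}$ with degree $1$ maps $l_k:\mathfrak{L}^{\otimes k}\to\mathfrak{L}$, $k\ge1$, that are graded symmetric, $l_k(x_{\sigma(1)},\ldots,x_{\sigma(k)})=\epsilon(\sigma)l_k(x_1,\ldots,x_k)$ with $\epsilon(\sigma)$ the Koszul sign, and satisfy $\sum_{i+j=n+1}\sum_{\sigma\in Sh(i,n-i)}\epsilon(\sigma)\,l_j(l_i(x_{\sigma(1)},\ldots,x_{\sigma(i)}),x_{\sigma(i+1)},\ldots,x_{\sigma(n)})=0$ for all $n\ge1$ and homogeneous $x_1,\ldots,x_n$. The maps are extended to permuted entries by graded symmetry. *)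

(* Defs.v *)
From HB Require Import structures.
From mathcomp Require Import all_boot all_order all_algebra all_fingroup.
From mathcomp Require Import boolp functions.

Set Implicit Arguments.
Unset Strict Implicit.
Unset Printing Implicit Defensive.
Import GRing.Theory.
Local Open Scope ring_scope.

(* A function on sequences stands for the whole family (f_n)_n of its
   restrictions to the sequences of length n.  It is multilinear when every
   f_n is n-linear, that is, when f_n is an element of Hom(U^{(x)n}, W). *)
Definition multilinear (K : fieldType) (U W : lmodType K) (f : seq U -> W) :=
  forall (s1 s2 : seq U) (a : K) (u v : U),
    f (s1 ++ (a *: u + v) :: s2) = a *: f (s1 ++ u :: s2) + f (s1 ++ v :: s2).

Definition Sh (p q : nat) : {set 'S_(p + q)} :=
  [set s : 'S_(p + q) |
    [forall a : 'I_(p + q), forall b : 'I_(p + q),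
      ((a < b)%N && ((b < p)%N || (p <= a)%N)) ==> (s a < s b)%N]].

(* (x_{s(1)}, ..., x_{s(n)}); entries of x of index >= n are dropped. *)
Definition reorder (T : nmodType) (n : nat) (s : 'S_n) (x : seq T) : seq T :=
  [seq x`_(s k) | k <- enum 'I_n].

Section Subspaces.
Variables (K : fieldType) (W : lmodType K).

Definition is_subspace (S : W -> Prop) :=
  S 0 /\ forall (a : K) (u v : W), S u -> S v -> S (a *: u + v).

Record subspace := Subspace { sub_prop :> W -> Prop;
                              sub_propP : is_subspace sub_prop }.

Definition sub_pred (S : subspace) : {pred W} := fun x => `[< S x >].

Lemma sub_pred_closed (S : subspace) : submod_closed (sub_pred S).
Proof.
case: (sub_propP S) => S0 SD; split; first by apply/asboolP.
by move=> a u v /asboolP Su /asboolP Sv; apply/asboolP; apply: SD.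
Qed.

HB.instance Definition _ (S : subspace) :=
  GRing.isSubmodClosed.Build K W (sub_pred S) (sub_pred_closed S).

Definition subspace_type (S : subspace) := {x : W | x \in sub_pred S}.

HB.instance Definition _ (S : subspace) := SubChoice.on (subspace_type S).
HB.instance Definition _ (S : subspace) :=
  [SubChoice_isSubLmodule of subspace_type S by <:].

Definition mk_sub (S : subspace) (x : W) (Sx : S x) : subspace_type S :=
  exist _ x (asboolT Sx).

Lemma mk_subK (S : subspace) (x : W) (Sx : S x) : \val (mk_sub Sx) = x.
Proof. by []. Qed.

Lemma subP (S : subspace) (x : subspace_type S) : S (\val x).
Proof. by apply/asboolP; exact: (valP x). Qed.

Definition sum_of (A : nat -> W -> Prop) (f : W) :=
  exists (N : nat) (c : nat -> W),
    (forall i, A i (c i)) /\ f = \sum_(i < N) c i.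

Lemma sum_of_subspace (A : nat -> W -> Prop) :
  (forall i, is_subspace (A i)) -> is_subspace (sum_of A).
Proof.
move=> Asub; split.
  exists 0%N, (fun=> 0); split; first by move=> i; case: (Asub i).
  by rewrite big_ord0.
move=> a u v [N [c [Ac ->]]] [N' [c' [Ac' ->]]].
exists (N + N')%N, (fun i => a *: (if (i < N)%N then c i else 0)
                          + (if (i < N')%N then c' i else 0)); split.
  move=> i; case: (Asub i) => A0 AD; apply: AD.
    by case: ifP => _; [exact: Ac | exact: A0].
  by case: ifP => _; [exact: Ac' | exact: A0].
rewrite big_split -scaler_sumr /=; congr (_ *: _ + _).
  rewrite (big_ord_widen (N + N') c (leq_addr _ _)) [LHS]big_mkcond /=.
  by apply: eq_bigr.
rewrite (big_ord_widen (N + N') c' (leq_addl _ _)) [LHS]big_mkcond /=.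
by apply: eq_bigr.
Qed.

Lemma sum_of_incl (A : nat -> W -> Prop) (i : nat) (f : W) :
  (forall i, is_subspace (A i)) -> A i f -> sum_of A f.
Proof.
move=> Asub Af; exists i.+1, (fun j => if j == i then f else 0); split.
  by move=> j; case: eqP => [->//|_]; case: (Asub j).
rewrite big_ord_recr /= eqxx big1 ?add0r // => j _.
by rewrite ltn_eqF.
Qed.

End Subspaces.

Section Cochains.
Variables (K : fieldType) (E : lmodType K).

(* Finitely supported families (f_n)_{n >= 1}, f_n in Hom(E^{(x)n}, E). *)
Definition is_cochain (f : seq E -> E) :=
  [/\ f [::] = 0, multilinear f
    & exists N : nat, forall x, (N < size x)%N -> f x = 0].

Lemma multilinear0 (f : seq E -> E) s1 s2 :
  multilinear f -> f (s1 ++ 0 :: s2) = 0.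
Proof.
move=> /(_ s1 s2 1 0 0); rewrite !scale1r addr0.
by move=> /(congr1 (fun z => z - f (s1 ++ 0 :: s2))); rewrite addrK subrr.
Qed.

Lemma is_cochain_subspace : is_subspace (is_cochain : (seq E -> E) -> Prop).
Proof.
split; first by split=> // [s1 s2 a u v|]; [rewrite scaler0 addr0 | exists 0%N].
move=> a f g [f0 fM [N fN]] [g0 gM [N' gN]].
have lin x : (a *: f + g) x = a *: f x + g x by [].
split; rewrite ?lin.
- by rewrite f0 g0 scaler0 addr0.
- move=> s1 s2 b u v; rewrite !lin fM gM !scalerDr !scalerA.
  by rewrite [b * a]mulrC addrACA.
- exists (N + N')%N => x xN; rewrite lin fN ?gN ?scaler0 ?addr0 //.
    exact: leq_ltn_trans (leq_addl _ _) xN.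
  exact: leq_ltn_trans (leq_addr _ _) xN.
Qed.

Definition cochain_space : subspace (seq E -> E) :=
  Subspace is_cochain_subspace.

(* C^{* + 1}(E, E) *)
Definition cochain := subspace_type cochain_space.
HB.instance Definition _ := GRing.Lmodule.on cochain.

(* C^{n + 1}(E, E) *)
Definition cdeg (n : int) (f : cochain) :=
  forall x, (size x)%:Z <> n + 1 -> \val f x = 0.

(* The operation f <> g for f in C^{m+1}(E,E) and g in C^{n+1}(E,E); here
   j = i - 1, and the entries of x are numbered from 0. *)
Definition diamond (m n : nat) (f g : seq E -> E) (x : seq E) : E :=
  \sum_(j < m.+1) (-1) ^+ (j * n) *:
    \sum_(s in Sh j n) (-1) ^+ odd_perm s *:
      f (take j (reorder s x) ++
         g (drop j (reorder s x) ++ [:: x`_(j + n)]) ::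
         drop (j + n).+1 x).

(* The bilinear extension of the bracket [f, g]_B to all of C^{* + 1}(E, E):
   in the (m, n) summand f and g are only evaluated on sequences of length
   m + 1 and n + 1, so that only their components in C^{m+1} and C^{n+1}
   contribute. *)
Definition bracket_fun (f g : seq E -> E) (x : seq E) : E :=
  \sum_(m < size x) let n := ((size x).-1 - m)%N in
    diamond m n f g x - (-1) ^+ (m * n) *: diamond n m g f x.

Lemma size_reorder (T : nmodType) n (s : 'S_n) (x : seq T) :
  size (reorder s x) = n.
Proof. by rewrite size_map size_enum_ord. Qed.

Definition plug (j n : nat) (f g : seq E -> E) (z : seq E) : E :=
  f (take j z ++ g (take n.+1 (drop j z)) :: drop (j + n).+1 z).

Lemma plug_reorder m n j f g (s : 'S_(j + n)) (x : seq E) :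
  (j <= m)%N -> size x = (m + n).+1 ->
  f (take j (reorder s x) ++ g (drop j (reorder s x) ++ [:: x`_(j + n)]) ::
     drop (j + n).+1 x) = plug j n f g (reorder s x ++ drop (j + n) x).
Proof.
move=> jm sx; rewrite /plug.
have szr := size_reorder s x.
have ltx : (j + n < size x)%N by rewrite sx ltnS leq_add2r.
rewrite take_cat szr.
have -> : (if (j < j + n)%N then take j (reorder s x)
     else reorder s x ++ take (j - (j + n)) (drop (j + n) x))
   = take j (reorder s x).
  case: ltnP => // h; have n0 : n = 0%N.
    by apply/eqP; rewrite -leqn0 -(leq_add2l j) addn0.
  rewrite (eqP (_ : j - (j + n) == 0)%N) ?subn_eq0 ?leq_addr //.
  by rewrite take0 cats0 take_oversize // szr n0 addn0.
congr (f (_ ++ g _ :: _)).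
  rewrite drop_cat szr; case: ltnP => h.
    rewrite take_cat size_drop szr addKn ltnNge leqnSn /= subSnn.
    by rewrite (drop_nth 0 ltx) /= take0.
  have n0 : n = 0%N by apply/eqP; rewrite -leqn0 -(leq_add2l j) addn0.
  rewrite (eqP (_ : j - (j + n) == 0)%N) ?subn_eq0 ?leq_addr // drop0.
  rewrite drop_oversize ?szr ?n0 ?addn0 //= -?n0.
  by rewrite n0 addn0 in ltx *; rewrite (drop_nth 0 ltx) /= take0.
rewrite drop_cat szr ltnNge leqnSn /= subSnn.
by rewrite (drop_nth 0 ltx) /= drop0.
Qed.

Lemma plug_multilinear j n f g t1 t2 a u v :
  multilinear f -> multilinear g -> (j + n < size t1 + (size t2).+1)%N ->
  plug j n f g (t1 ++ (a *: u + v) :: t2) =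
  a *: plug j n f g (t1 ++ u :: t2) + plug j n f g (t1 ++ v :: t2).
Proof.
move=> fM gM szt; rewrite /plug.
case: (ltnP (size t1) j) => h1.
  have tk w : take j (t1 ++ w :: t2) = t1 ++ w :: take (j - size t1).-1 t2.
    rewrite take_cat ltnNge (ltnW h1) /=; move: h1; rewrite -subn_gt0.
    by case: (j - size t1)%N.
  have dr k w : (j <= k)%N ->
      drop k (t1 ++ w :: t2) = drop (k - size t1).-1 t2.
    move=> jk; have h := leq_trans h1 jk.
    rewrite drop_cat ltnNge (ltnW h) /=; move: h; rewrite -subn_gt0.
    by case: (k - size t1)%N.
  rewrite !tk !(dr j) // !(dr (j + n).+1) ?(leqW (leq_addr _ _)) // -!catA /=.
  exact: fM.
have tk w : take j (t1 ++ w :: t2) = take j t1.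
  by rewrite takel_cat.
rewrite !tk.
case: (ltnP (j + n) (size t1)) => h2.
  have dr w : drop (j + n).+1 (t1 ++ w :: t2) = drop (j + n).+1 t1 ++ w :: t2.
    rewrite drop_cat; case: ltnP => // h3.
    have -> : (j + n).+1 = size t1 by apply/eqP; rewrite eqn_leq h2 h3.
    by rewrite subnn drop0 drop_size.
  have mid w : take n.+1 (drop j (t1 ++ w :: t2)) = take n.+1 (drop j t1).
    have jl : (j < size t1)%N := leq_ltn_trans (leq_addr _ _) h2.
    rewrite drop_cat jl takel_cat // size_drop ltn_subRL //.
  rewrite !dr !mid; set A := take j t1; set B := g _; set D := drop _ t1.
  have := fM (A ++ B :: D) t2 a u v.
  by rewrite -!catA /=.
have dr w : drop (j + n).+1 (t1 ++ w :: t2) = drop (j + n - size t1) t2.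
  by rewrite drop_cat ltnNge (leqW h2) /= subSn.
have mid w : take n.+1 (drop j (t1 ++ w :: t2)) =
    drop j t1 ++ w :: take (n - (size t1 - j)) t2.
  have -> : drop j (t1 ++ w :: t2) = drop j t1 ++ w :: t2.
    rewrite drop_cat; case: ltnP => // h3.
    have -> : j = size t1 by apply/eqP; rewrite eqn_leq h1 h3.
    by rewrite subnn drop0 drop_size.
  have h3 : (size t1 - j <= n)%N by rewrite leq_subLR.
  by rewrite take_cat size_drop ltnNge (leqW h3) /= subSn.
by rewrite !dr !mid gM fM.
Qed.

Lemma reindex_one (idx : seq nat) (s1 s2 : seq E) :
  uniq idx -> size s1 \in idx ->
  exists t1 t2, forall w, [seq (s1 ++ w :: s2)`_i | i <- idx] = t1 ++ w :: t2.
Proof.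
move=> ui /path.splitPr H; case: H ui => i1 i2.
rewrite cat_uniq /= => /and3P[_ /norP[n1 _] /andP[n2 _]].
have nE w i : i != size s1 -> (s1 ++ w :: s2)`_i = (s1 ++ 0 :: s2)`_i.
  move=> ni; rewrite !nth_cat; case: ltnP => // h.
  have : (0 < i - size s1)%N by rewrite subn_gt0 ltn_neqAle eq_sym ni.
  by case: (i - size s1)%N.
exists [seq (s1 ++ 0 :: s2)`_i | i <- i1], [seq (s1 ++ 0 :: s2)`_i | i <- i2].
move=> w; rewrite map_cat /=; congr (_ ++ _ :: _).
- apply/eq_in_map => i ii; apply: nE; apply: contraNneq n1 => <- //.
- by rewrite nth_cat ltnn subnn.
- by apply/eq_in_map => i ii; apply: nE; apply: contraNneq n2 => <-.
Qed.

Lemma reorder_split m n j (s : 'S_(j + n)) (s1 s2 : seq E) :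
  (j <= m)%N -> (size s1 + (size s2).+1)%N = (m + n).+1 ->
  exists t1 t2, (size t1 + (size t2).+1)%N = (m + n).+1 /\ forall w,
   reorder s (s1 ++ w :: s2) ++ drop (j + n) (s1 ++ w :: s2) = t1 ++ w :: t2.
Proof.
move=> jm sz; pose idx := [seq val (s k) | k <- enum 'I_(j + n)] ++
                          iota (j + n) (m - j).+1.
have ltE i : (i < j + n)%N -> i \in [seq val (s k) | k <- enum 'I_(j + n)].
  move=> hi; apply/mapP; exists ((s^-1)%g (Ordinal hi)).
    by rewrite mem_enum.
  by rewrite permKV.
have gtE i : i \in [seq val (s k) | k <- enum 'I_(j + n)] -> (i < j + n)%N.
  by case/mapP => k _ ->; exact: ltn_ord (s k).
have jmn : (j + n + (m - j).+1 = (m + n).+1)%N.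
  by rewrite addnS addnAC subnKC.
have ui : uniq idx.
  have u1 : uniq [seq val (s k) | k <- enum 'I_(j + n)].
    by rewrite map_inj_uniq ?enum_uniq // => a b /val_inj/perm_inj.
  rewrite cat_uniq u1 iota_uniq andbT; apply/hasPn => i.
  rewrite mem_iota => /andP[h _].
  by apply/negP => /gtE; rewrite ltnNge h.
have pin : size s1 \in idx.
  rewrite mem_cat; case: (ltnP (size s1) (j + n)) => h; first by rewrite ltE.
  by rewrite mem_iota h jmn -sz addnS ltnS leq_addr orbT.
have [t1 [t2 tE]] := reindex_one s2 ui pin.
have szE w : size (s1 ++ w :: s2) = (m + n).+1 by rewrite size_cat.
have idE w : reorder s (s1 ++ w :: s2) ++ drop (j + n) (s1 ++ w :: s2) =
             [seq (s1 ++ w :: s2)`_i | i <- idx].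
  rewrite map_cat -map_comp; congr (_ ++ _).
  apply: (@eq_from_nth _ 0).
    by rewrite size_drop size_map size_iota szE -jmn addKn.
  move=> i; rewrite size_drop szE -jmn addKn => hi.
  by rewrite nth_drop (nth_map 0%N) ?size_iota // nth_iota.
exists t1, t2; split; last by move=> w; rewrite idE tE.
have /(congr1 size) := tE 0.
rewrite size_map !size_cat size_map size_enum_ord size_iota /= jmn.
by move=> ->.
Qed.

Lemma diamond_multilinear m n f g s1 s2 a u v :
  multilinear f -> multilinear g -> (size s1 + (size s2).+1)%N = (m + n).+1 ->
  diamond m n f g (s1 ++ (a *: u + v) :: s2) =
  a *: diamond m n f g (s1 ++ u :: s2) + diamond m n f g (s1 ++ v :: s2).
Proof.
move=> fM gM sz; rewrite /diamond scaler_sumr -big_split /=.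
apply: eq_bigr => j _; have jm : (j <= m)%N by rewrite -ltnS.
rewrite scalerA mulrC -scalerA -scalerDr; congr (_ *: _).
rewrite scaler_sumr -big_split /=; apply: eq_bigr => s _.
rewrite scalerA mulrC -scalerA -scalerDr; congr (_ *: _).
rewrite !(plug_reorder f g s jm) ?size_cat //.
have [t1 [t2 [szt tE]]] := reorder_split s jm sz.
rewrite !tE; apply: plug_multilinear => //.
by rewrite szt ltnS leq_add2r.
Qed.

Lemma diamond_vanish m n f g N N' x :
  multilinear f ->
  (forall y, (N < size y)%N -> f y = 0) ->
  (forall y, (N' < size y)%N -> g y = 0) ->
  size x = (m + n).+1 -> (N <= m)%N || (N' <= n)%N ->
  diamond m n f g x = 0.
Proof.
move=> fM fN gN sx big; rewrite /diamond big1 // => j _.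
have jm : (j <= m)%N by rewrite -ltnS.
rewrite big1 ?scaler0 // => s _.
have szr := size_reorder s x.
case/orP: big => h.
  rewrite fN ?scaler0 // size_cat /= size_take size_drop szr sx.
  rewrite subSS addnS ltnS; case: ltnP => h'.
    by rewrite subnDr subnKC.
  have n0 : n = 0%N by apply/eqP; rewrite -leqn0 -(leq_add2l j) addn0.
  by rewrite subnDr n0 addn0 subnKC.
rewrite gN ?multilinear0 ?scaler0 // size_cat size_drop szr addKn addn1.
by rewrite ltnS.
Qed.

Lemma bracket_cochain (f g : cochain) :
  cochain_space (bracket_fun (\val f) (\val g)).
Proof.
have [_ fM [N fN]] := subP f; have [_ gM [N' gN]] := subP g.
have sub k (m : 'I_k) : (m + (k.-1 - m)).+1 = k.
  case: k m => [[]//|k] m /=; rewrite subnKC // -ltnS; exact: ltn_ord.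
split.
- by rewrite /bracket_fun /= big_ord0.
- move=> s1 s2 a u v; rewrite /bracket_fun.
  rewrite !size_cat /= scaler_sumr -big_split /=; apply: eq_bigr => m _.
  have sz := sub _ m; have flip r p q : (p + q).+1 = r -> r = (q + p).+1.
    by move=> <-; rewrite addnC.
  rewrite !diamond_multilinear //; last exact: flip.
  rewrite scalerBr scalerDr !scalerA [a * _]mulrC opprD addrACA.
  by [].
- exists (N + N').+1 => x xN; rewrite /bracket_fun big1 // => m _ /=.
  have sz := sub _ m; set n := (_ - _)%N in sz *.
  have big : (N <= m)%N || (N' <= n)%N.
    case: leqP => //= h; rewrite leqNgt; apply/negP => h'.
    move: xN; rewrite -sz ltnS ltnNge => /negP; apply.
    by apply: leq_add; exact: ltnW.
  rewrite (diamond_vanish fM fN gN) // (diamond_vanish gM gN fN) //.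
  + by rewrite scaler0 subr0.
  + by rewrite [in RHS]addnC.
  + by rewrite orbC.
Qed.

Definition bracket (f g : cochain) : cochain := mk_sub (bracket_cochain f g).

(* On homogeneous elements, [f, g]_B is f <> g - (-1)^{mn} g <> f. *)
Lemma bracket_homogeneous (m n : nat) (f g : cochain) :
  cdeg m f -> cdeg n g -> cdeg (m + n)%N (bracket f g) /\
  forall x, size x = (m + n).+1 ->
    \val (bracket f g) x =
      diamond m n (\val f) (\val g) x
      - (-1) ^+ (m * n) *: diamond n m (\val g) (\val f) x.
Proof.
move=> fm gn.
have [_ fM _] := subP f; have [_ gM _] := subP g.
have dia0 p q a b (A B : cochain) x : cdeg a A -> cdeg b B ->
    multilinear (\val A) -> size x = (p + q).+1 ->
    (p%:Z != a) || (q%:Z != b) -> diamond p q (\val A) (\val B) x = 0.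
  move=> Aa Bb AM sx ne; rewrite /diamond big1 // => j _.
  have jm : (j <= p)%N by rewrite -ltnS.
  rewrite big1 ?scaler0 // => s _; have szr := size_reorder s x.
  case/orP: ne => ne.
    rewrite Aa ?scaler0 // size_cat /= size_take size_drop szr sx.
    rewrite subSS addnS subnDr.
    have -> : (if (j < j + q)%N then j : nat else (j + q)%N) = j.
      case: ltnP => // h; apply/eqP.
      by rewrite eqn_leq h leq_addr.
    by rewrite subnKC // intS [1 + _]addrC => /addIr/eqP; apply/negP.
  rewrite Bb ?multilinear0 ?scaler0 // size_cat size_drop szr addKn addn1.
  by rewrite intS [1 + _]addrC => /addIr/eqP; apply/negP.
have sub k (p : 'I_k) : (p + (k.-1 - p)).+1 = k.
  case: k p => [[]//|k] p /=; rewrite subnKC // -ltnS; exact: ltn_ord.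
split=> [x sx|x sx]; rewrite /= /bracket_fun.
  rewrite big1 // => p _ /=; have sz := sub _ p; set q := (_ - _)%N in sz *.
  have ne : (p%:Z != m) || (q%:Z != n).
    rewrite -negb_and; apply/negP => /andP[/eqP[pm] /eqP[qn]].
    by apply: sx; rewrite -sz pm qn intS [1 + _]addrC.
  rewrite (dia0 _ _ _ _ _ _ _ fm gn) // (dia0 _ _ _ _ _ _ _ gn fm) //.
  + by rewrite scaler0 subr0.
  + by rewrite [in RHS]addnC.
  + by rewrite orbC.
have hm : (m < size x)%N by rewrite sx ltnS leq_addr.
rewrite (bigD1 (Ordinal hm)) //= big1 ?addr0 => [|p pm].
  by rewrite sx /= addKn.
have sz := sub _ p; set q := (_ - _)%N in sz *.
have ne : (p%:Z != m) || (q%:Z != n).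
  apply/orP; left; apply: contraNneq pm => -[pm].
  by apply/eqP; apply: val_inj.
rewrite (dia0 _ _ _ _ _ _ _ fm gn) // (dia0 _ _ _ _ _ _ _ gn fm) //.
+ by rewrite scaler0 subr0.
+ by rewrite [in RHS]addnC.
+ by rewrite orbC.
Qed.

End Cochains.

Definition sum_inj (K : fieldType) (U W : lmodType K) (t : U + W) : U * W :=
  match t with inl u => (u, 0) | inr w => (0, w) end.

Section Bidegree.
Variables (K : fieldType) (g V : lmodType K).

Local Notation E := (g * V)%type.

(* The tensor products x_1 (x) ... (x) x_{p+q} with p entries in g and q
   entries in V, in any order; these span g^{p,q}. *)
Definition in_gV (p q : int) (t : seq (g + V)) :=
  (count (fun y => is_inl y) t)%:Z = p /\
  (count (fun y => ~~ is_inl y) t)%:Z = q.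

(* C^{k|l}(g (+) V, g (+) V), for k, l >= -1 and k + l >= 0 *)
Definition bideg (k l : int) (f : cochain E) :=
  [/\ cdeg (k + l) f,
      forall t, in_gV (k + 1) l t -> (\val f (map (@sum_inj K g V) t)).2 = 0,
      forall t, in_gV k (l + 1) t -> (\val f (map (@sum_inj K g V) t)).1 = 0
    & forall t, ~ in_gV (k + 1) l t -> ~ in_gV k (l + 1) t ->
        \val f (map (@sum_inj K g V) t) = 0].

Lemma bideg_subspace (k l : int) : is_subspace (bideg k l).
Proof.
split; first by split.
move=> a u v [u1 u2 u3 u4] [v1 v2 v3 v4].
have lin x : \val (a *: u + v) x = a *: \val u x + \val v x by [].
split=> [x hx|t ht|t ht|t ht ht']; rewrite lin.
- by rewrite u1 // v1 // scaler0 addr0.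
- by rewrite /= u2 // v2 // scaler0 addr0.
- by rewrite /= u3 // v3 // scaler0 addr0.
- by rewrite u4 // v4 // scaler0 addr0.
Qed.

Definition Lprime_space : subspace (cochain E) :=
  Subspace (sum_of_subspace (fun k : nat => bideg_subspace k 0)).

(* L' = (+)_{k >= 0} C^{k|0} *)
Definition Lprime := subspace_type Lprime_space.
HB.instance Definition _ := GRing.Lmodule.on Lprime.

Definition a_space : subspace (cochain E) :=
  Subspace (sum_of_subspace (fun l : nat => bideg_subspace (-1) (l%:Z + 1))).

(* a = (+)_{l >= 0} C^{-1|l+1} *)
Definition fra := subspace_type a_space.
HB.instance Definition _ := GRing.Lmodule.on fra.

Definition Lprime_deg (i : int) (q : Lprime) :=
  if 0 <= i then bideg i 0 (\val q) else q = 0.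

Definition fra_deg (i : int) (a : fra) :=
  if 0 <= i then bideg (-1) (i + 1) (\val a) else a = 0.

(* L'[1] (+) a *)
Definition shifted_deg (i : int) (z : Lprime * fra) :=
  Lprime_deg (i + 1) z.1 /\ fra_deg i z.2.

(* The components in L, that is, in C^{* + 1}(g (+) V, g (+) V). *)
Definition to_L (z : Lprime * fra) : cochain E * cochain E :=
  (\val z.1, \val z.2).

Definition is_projection_on_a (P : cochain E -> cochain E) :=
  [/\ forall f, a_space (P f),
      forall f, a_space f -> P f = f
    & forall (k l : int) (f : cochain E),
        0 <= k -> -1 <= l -> 0 <= k + l -> bideg k l f -> P f = 0].

(* The projection P exists: the decomposition of C^{* + 1}(E, E) into the
   C^{k|l} makes it f |-> pr_g o f o (pr_V (x) ... (x) pr_V). *)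

Definition to_V (x : E) : E := (0, x.2).

Definition proj_fun (f : seq E -> E) (x : seq E) : E :=
  ((f (map to_V x)).1, 0).

Lemma proj_cochain (f : cochain E) : cochain_space E (proj_fun (\val f)).
Proof.
have [f0 fM [N fN]] := subP f; split.
- by rewrite /proj_fun /= f0.
- move=> s1 s2 a u v; rewrite /proj_fun !map_cat /=.
  have -> : to_V (a *: u + v) = a *: to_V u + to_V v.
    by rewrite /to_V; congr pair; rewrite /= scaler0 addr0.
  by rewrite fM; congr pair; rewrite /= scaler0 addr0.
- by exists N => x xN; rewrite /proj_fun fN ?size_map.
Qed.

Definition proj (f : cochain E) : cochain E := mk_sub (proj_cochain f).

Lemma proj_linear : linear proj.
Proof.
move=> a u v; apply: val_inj; apply/funext => x.
change (proj_fun (a *: \val u + \val v) x =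
  a *: proj_fun (\val u) x + proj_fun (\val v) x).
by rewrite /proj_fun; congr pair; rewrite /= scaler0 addr0.
Qed.

HB.instance Definition _ :=
  GRing.isLinear.Build K (cochain E) (cochain E) *:%R proj proj_linear.

Definition trunc_fun (n : nat) (f : seq E -> E) (x : seq E) : E :=
  if size x == n.+1 then f x else 0.

Lemma trunc_cochain (n : nat) (f : cochain E) :
  cochain_space E (trunc_fun n (\val f)).
Proof.
have [f0 fM [N fN]] := subP f; split=> //.
- move=> s1 s2 a u v; rewrite /trunc_fun !size_cat /=.
  by case: ifP => _; [exact: fM | rewrite scaler0 addr0].
- by exists N => x xN; rewrite /trunc_fun fN // if_same.
Qed.

Definition trunc n (f : cochain E) : cochain E := mk_sub (trunc_cochain n f).

Local Notation inj := (map (@sum_inj K g V)).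

Lemma to_V_killed (f : seq E -> E) (t : seq (g + V)) :
  multilinear f -> has (fun y => is_inl y) t -> f (map to_V (inj t)) = 0.
Proof.
move=> fM; rewrite has_count => /idP; rewrite -has_count => ht.
have /split_find[y t1 t2 hy _] := ht.
by case: y hy => // y _; rewrite -cats1 -catA !map_cat /= multilinear0.
Qed.

Lemma proj_in_a (f : cochain E) : a_space (proj f).
Proof.
have [f0 fM [N fN]] := subP f.
exists N, (fun n => trunc n (proj f)); split=> [n|].
  split=> [x hx|t _|t [ht _]|t nt _].
  - rewrite /= /trunc_fun; case: eqP => // sx; case: hx.
    by rewrite sx intS addrC; congr (_ + 1); rewrite addrCA addNr addr0.
  - by rewrite /= /trunc_fun; case: ifP.
  - by [].
  - rewrite /= /trunc_fun; case: eqP => // sx.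
    rewrite /proj_fun to_V_killed //; rewrite has_count lt0n.
    apply: contra_notN nt => /eqP c0.
    have := count_predC (fun y : g + V => is_inl y) t.
    rewrite c0 -(size_map (@sum_inj K g V)) sx add0n => c1.
    split; first by rewrite c0 addNr.
    by rewrite [count _ _]c1 intS; apply: addrC.
apply: val_inj; apply/funext => x.
have vsum (r : seq nat) (c : nat -> cochain E) :
    \val (\sum_(i <- r) c i) x = \sum_(i <- r) \val (c i) x.
  by elim: r => [|i r IH]; rewrite ?big_nil // !big_cons -IH.
rewrite -(big_mkord xpredT (fun n => trunc n (proj f))) vsum big_mkord.
case: x {vsum} => [|y x] /=.
  by rewrite /proj_fun /= f0 big1.
case: (ltnP (size x) N) => h.
  rewrite (bigD1 (Ordinal h)) //= {1}/trunc_fun eqxx big1 ?addr0 // => i ni.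
  rewrite /trunc_fun /= eqSS; case: eqP => // si; case/eqP: ni.
  exact: val_inj.
rewrite big1 => [|i _]; first by rewrite /proj_fun fN ?size_map.
rewrite /trunc_fun /= eqSS; case: eqP => // si.
by have := ltn_ord i; rewrite -si ltnNge h.
Qed.

Lemma to_V_only (f : seq E -> E) : multilinear f ->
  (forall t, has (fun y => is_inl y) t -> f (inj t) = 0) ->
  forall x, f x = f (map to_V x).
Proof.
move=> fM f0.
have split1 w (y : E) s : f (inj w ++ y :: s) =
    f (inj (rcons w (inl y.1)) ++ s) + f (inj (rcons w (inr y.2)) ++ s).
  have {1}-> : y = 1 *: (y.1, 0) + (0, y.2) :> E.
    by case: y => y1 y2; congr pair; rewrite /= ?scale1r ?addr0 ?scaler0 ?add0r.
  by rewrite fM scale1r !map_rcons -!cats1 -!catA.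
have kill s w : has (fun y => is_inl y) w -> f (inj w ++ s) = 0.
  elim: s w => [|y s IH] w hw; first by rewrite cats0 f0.
  by rewrite split1 !IH ?addr0 // has_rcons hw orbT.
have main s w : f (inj w ++ s) = f (inj w ++ map to_V s).
  elim: s w => [//|y s IH] w.
  rewrite split1 kill ?has_rcons // add0r IH /=.
  by rewrite map_rcons -cats1 -catA.
by move=> x; exact: (main x [::]).
Qed.

Lemma proj_bideg_a (l : nat) (f : cochain E) :
  bideg (-1) (l%:Z + 1) f -> proj f = f.
Proof.
move=> [_ f2 f1 f0]; have [_ fM _] := subP f.
have kill t : has (fun y => is_inl y) t -> \val f (inj t) = 0.
  rewrite has_count => ht; apply: f0 => -[] //.
  by case=> c0; rewrite c0 in ht.
apply: val_inj; apply/funext => x; rewrite [RHS](to_V_only fM kill) /=.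
rewrite /proj_fun [RHS]surjective_pairing; congr pair; apply/esym.
set t : seq (g + V) := [seq inr y.2 | y <- x].
have -> : map to_V x = inj t.
  by rewrite -map_comp; apply: eq_map.
case: (pselect (in_gV (-1 + 1) (l%:Z + 1) t)) => [|nt]; first exact: f2.
by rewrite f0 // => -[].
Qed.

Lemma proj_bideg (k l : int) (f : cochain E) :
  0 <= k -> bideg k l f -> proj f = 0.
Proof.
move=> k0 [_ f2 f1 f0]; apply: val_inj; apply/funext => x /=.
rewrite /proj_fun; set t : seq (g + V) := [seq inr y.2 | y <- x].
have -> : map to_V x = inj t.
  by rewrite -map_comp; apply: eq_map.
suff -> : (\val f (inj t)).1 = 0 by [].
case: (pselect (in_gV k (l + 1) t)) => [|nt]; first exact: f1.
rewrite f0 // => -[ct _].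
have : count (fun y => is_inl y) t = 0%N.
  by rewrite /t; elim: (x) => //= y s ->.
move=> c0; move: ct; rewrite c0 => ct.
by have : 0 < k + 1 :> int; [rewrite ltzD1 | rewrite -ct].
Qed.

Lemma projection_on_a_exists :
  exists P : {linear cochain E -> cochain E}, is_projection_on_a P.
Proof.
exists proj; split=> [f|f [N [c [Ac ->]]]|k l f k0 _ _ fkl].
- exact: proj_in_a.
- by rewrite linear_sum; apply: eq_bigr => i _; exact: proj_bideg_a.
- exact: proj_bideg fkl.
Qed.

End Bidegree.

Section LInfinity.
Variables (K : fieldType) (M : lmodType K).

Definition is_grading (gr : int -> M -> Prop) :=
  [/\ forall i, is_subspace (gr i),
      forall z, exists (r : seq int) (c : int -> M),
        (forall i, gr i (c i)) /\ z = \sum_(i <- r) c i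
    & forall (r : seq int) (c : int -> M), uniq r ->
        (forall i, gr i (c i)) -> \sum_(i <- r) c i = 0 ->
        forall i, i \in r -> c i = 0].

(* x_0, ..., x_{n-1} are homogeneous of degrees d 0, ..., d (n - 1). *)
Definition homogeneous (gr : int -> M -> Prop) (d : nat -> int) (x : seq M) :=
  forall i, (i < size x)%N -> gr (d i) x`_i.

(* epsilon(s), for entries of degrees d 0, ..., d (n - 1) *)
Definition koszul (d : nat -> int) (n : nat) (s : 'S_n) : K :=
  \prod_(i < n) \prod_(j < n | (i < j)%N && (s j < s i)%N)
    (-1) ^ (d (s i) * d (s j)).

(* l_k is the restriction of l to the sequences of length k; the value of l
   at the empty sequence is irrelevant. *)
Definition Linfty_algebra (gr : int -> M -> Prop) (l : seq M -> M) :=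
  [/\ is_grading gr,
      multilinear l,
      forall d x, (0 < size x)%N -> homogeneous gr d x ->
        gr (\sum_(i < size x) d i + 1) (l x),
      forall d x (s : 'S_(size x)), homogeneous gr d x ->
        l (reorder s x) = koszul d s *: l x
    & forall d x, (0 < size x)%N -> homogeneous gr d x ->
        \sum_(1 <= i < (size x).+1) \sum_(s in Sh i (size x - i))
          koszul d s *:
            l (l (take i (reorder s x)) :: drop i (reorder s x)) = 0].

End LInfinity.

(* Main.v *)
Require Import Defs.
From HB Require Import structures.
From mathcomp Require Import all_boot all_order all_algebra all_fingroup.
From mathcomp Require Import boolp functions ring zify.

(* The component of [f <> g] at a sequence [y :: x] is computed by letting [y]
   be the only argument of [g], a first argument of [f], or a first argument of
   [g].  An induction on this recursion gives the graded pre-Lie identity of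
   [<>], hence the graded Jacobi identity of the bracket.

   The structure maps are Voronov's higher derived brackets.  For a sequence [x]
   of entries [q_i[1] + a_i], let [Phi x] be the signed sum over [i] of the
   iterated brackets of [q_i] with the [a_j], [j <> i], so that the component of
   the structure map in [a] is [P (Phi x)].  By the Leibniz rule and since [a]
   is abelian, the signed sum of the [[Phi A, Phi B]] over the unshuffles
   [(A, B)] of [x] is twice the sum over [i < j] of the iterated brackets of
   [[q_i, q_j]] with the other [a_k].  Since
   [P [X, Y] = P [P X, Y] + P [X, P Y]], applying [P] gives twice the
   generalized Jacobi identity: the left-hand side becomes the terms whose inner operation
   takes its value in [a], the right-hand side those with inner operation
   [l_2 (q_i[1], q_j[1])]. *)

Set Implicit Arguments.
Unset Strict Implicit.
Unset Printing Implicit Defensive.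
Import GRing.Theory.
Local Open Scope ring_scope.

(** * Koszul signs and unshuffles *)

(** Every sign depends on degrees only modulo 2, so the derived-bracket argument runs in an abstract
    Lie superalgebra with a parity predicate [hom]; integer degrees return for the grading and the
    bidegrees. Two features of the statement shape the construction. The structure map is one
    multilinear function on sequences of possibly inhomogeneous entries, whereas its signs involve
    degrees: they are therefore read off arities by the involution [twist], equal to (-1)^n on a
    component of degree n. And the symmetry and Jacobi conditions range over permutations, while all
    computations recurse on lists: [lift_perm], which records where the first entry goes, links the
    two. With all entries odd the same device handles the signed shuffles of [diamond]. The map is
    built with the explicit [proj], for which P [X, Y] = P [P X, Y] + P [X, P Y] holds because its
    kernel, the cochains sending tensors of V into V, is a subalgebra and its image is abelian. The
    given P is compared with [proj] only on iterated brackets, which have a bidegree k|l with l >=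
    0. Characteristic 0 serves to cancel the factor 2. *)

Lemma expN1z (K : fieldType) (z : int) :
  (-1 : K) ^ z = (-1) ^+ odd `|z|%N.
Proof.
case: z => n; first by rewrite signr_odd.
by rewrite NegzE -exprz_inv invrN1 signr_odd.
Qed.

(** Sorts permutations by the preimage [i] of 0, which is the position that [reorder] gives to the
    first entry; this is what permits induction on the list. *)
Lemma sum_perm_lift (W : nmodType) n (F : 'S_n.+1 -> W) :
  \sum_s F s = \sum_i \sum_(s : 'S_n) F (lift_perm i ord0 s).
Proof.
rewrite (partition_big (fun s : 'S_n.+1 => (s^-1)%g ord0) predT) //=.
apply: eq_bigr => i _.
rewrite (reindex (lift_perm i ord0)) /=.
  apply: eq_bigl => s; have := permK (lift_perm i ord0 s) i.
  by rewrite lift_perm_id => ->; rewrite eqxx.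
pose ulsf j (s : 'S_n.+1) k := odflt k (unlift (s j) (s (lift j k))).
have ulsfK j (s : 'S_n.+1) k : lift (s j) (ulsf j s k) = s (lift j k).
  rewrite /ulsf; have:= neq_lift j k.
  by rewrite -(can_eq (permK s)) => /unlift_some[] ? ? ->.
have inj_ulsf : injective (ulsf i _).
  move=> s; apply: can_inj (ulsf (s i) s^-1%g) _ => k'.
  by rewrite {1}/ulsf ulsfK !permK liftK.
exists (fun s => perm (inj_ulsf s)) => [s _ | s].
  by apply/permP=> k'; rewrite permE /ulsf lift_perm_lift lift_perm_id liftK.
rewrite inE => /eqP si; have si0 : s i = ord0 by rewrite -si permKV.
apply/permP=> k; case: (unliftP i k) => [k'|] ->; rewrite ?lift_perm_id //.
by rewrite lift_perm_lift -si0 permE ulsfK.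
Qed.

(** As [i] is sent to 0, its inversions are exactly the pairs with an earlier position; all other
    inversions are those of [s]. *)
Lemma koszul_lift (K : fieldType) (d : nat -> int) n (i : 'I_n.+1) (s : 'S_n) :
  koszul K d (lift_perm i ord0 s) =
  (\prod_(k < n | (k < i)%N) (-1) ^ (d (s k).+1 * d 0%N)) *
  koszul K (fun k => d k.+1) s.
Proof.
rewrite /koszul (bigD1_ord i) //= big1 ?mul1r => [|j /andP[_]]; last first.
  by rewrite lift_perm_id ltn0.
rewrite [X in _ = X * _]big_mkcond -big_split /=; apply: eq_bigr => k _.
rewrite big_mkcond (bigD1_ord i) //= lift_perm_id lift_perm_lift.
have -> : (bump i k < i)%N = (k < i)%N.
  by rewrite /bump; case: (leqP i k) => h; rewrite ?add1n // ltnNge (leqW h).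
rewrite !lift0 andbT; congr (_ * _).
rewrite [RHS]big_mkcond; apply: eq_bigr => j _.
by rewrite lift_perm_lift !lift0 ltnS ![(_ < bump _ _)%N]ltnNge leq_bump2
  -ltnNge.
Qed.

(** This is [Sh p q] with a free [n] in place of [p + q], so that an induction on [n] does not meet
    the sum inside a type. *)
Definition shuffles n p : {set 'S_n} :=
  [set s : 'S_n | [forall a : 'I_n, forall b : 'I_n,
     ((a < b)%N && ((b < p)%N || (p <= a)%N)) ==> (s a < s b)%N]].

Lemma shufflesP n p (s : 'S_n) :
  reflect (forall a b : 'I_n, (a < b)%N -> (b < p)%N || (p <= a)%N ->
             (s a < s b)%N) (s \in shuffles n p).
Proof.
rewrite inE; apply: (iffP forallP) => [h a b ab abp|h a].
  by have /forallP/(_ b)/implyP := h a; apply; rewrite ab.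
by apply/forallP => b; apply/implyP => /andP[]; exact: h.
Qed.

Lemma bump_lt i a b : (bump i a < bump i b)%N = (a < b)%N.
Proof. by rewrite !ltnNge leq_bump2. Qed.

Lemma lift_shuffles0 n p (s : 'S_n) :
  (lift_perm ord0 ord0 s \in shuffles n.+1 p.+1) = (s \in shuffles n p).
Proof.
apply/shufflesP/shufflesP => h a b.
  have := h (lift ord0 a) (lift ord0 b).
  by rewrite !lift_perm_lift /= !bump_lt /bump /= !add1n !ltnS.
case: (unliftP ord0 a) => [a'|] ->; case: (unliftP ord0 b) => [b'|] -> //=.
  by rewrite !lift_perm_lift /= !bump_lt /bump /= !add1n !ltnS; apply: h.
by rewrite lift_perm_id lift_perm_lift.
Qed.

Lemma lift_shuffles1 n p (lp : (p < n.+1)%N) (s : 'S_n) :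
  (lift_perm (Ordinal lp) ord0 s \in shuffles n.+1 p) = (s \in shuffles n p).
Proof.
set i := Ordinal lp.
have bl a : (bump p a < p)%N = (a < p)%N.
  by rewrite /bump; case: (leqP p a) => h; rewrite ?add1n // ltnNge (leqW h).
have bg a : (p <= bump p a)%N = (p <= a)%N by rewrite leqNgt bl -leqNgt.
apply/shufflesP/shufflesP => h a b.
  have := h (lift i a) (lift i b).
  by rewrite !lift_perm_lift /= !bump_lt bl bg.
case: (unliftP i a) => [a'|] ->; case: (unliftP i b) => [b'|] -> /=.
- by rewrite !lift_perm_lift /= !bump_lt bl bg; apply: h.
- by rewrite ltnn /= => h1 h2; move: h1; rewrite ltnNge h2.
- by rewrite lift_perm_id lift_perm_lift.
- by rewrite ltnn.
Qed.

(** The smallest value must head one of the two increasing blocks, so it sits at position 0 or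
    [p]. *)
Lemma lift_shufflesN n p (i : 'I_n.+1) (s : 'S_n) :
  lift_perm i ord0 s \in shuffles n.+1 p -> i <> p :> nat -> i = ord0.
Proof.
move=> /shufflesP h ip; apply/eqP; case: (ltngtP i p) => // ilp.
  apply: contraT => i0; have := h ord0 i.
  by rewrite lift_perm_id ltn0 ilp /= lt0n => ->.
have := h (Ordinal (ltn_trans ilp (ltn_ord i))) i ilp.
by rewrite /= leqnn orbT lift_perm_id ltn0 => /(_ isT).
Qed.

Lemma reorder_lift (T : nmodType) n (i : 'I_n.+1) (s : 'S_n) (y : T) x :
  reorder (lift_perm i ord0 s) (y :: x) =
  take i (reorder s x) ++ y :: drop i (reorder s x).
Proof.
have sr := size_reorder s x; have le_i : (i <= n)%N by rewrite -ltnS.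
have st : size (take i (reorder s x)) = i by rewrite size_takel ?sr.
apply: (@eq_from_nth _ 0).
  by rewrite size_reorder size_cat /= st size_drop sr addnS subnKC.
move=> k; rewrite size_reorder => lk; rewrite nth_cat st.
rewrite /reorder (nth_map ord0) ?size_enum_ord //.
have -> : nth ord0 (enum 'I_n.+1) k = Ordinal lk.
  by apply: val_inj; rewrite /= nth_enum_ord.
have : k = Ordinal lk by [].
move: (Ordinal lk) => {lk} kk ->; rewrite -/(reorder s x).
case: (unliftP i kk) => [j|] ->; last first.
  by rewrite lift_perm_id ltnn subnn.
rewrite lift_perm_lift lift0 /= /bump; case: (leqP i j) => ij.
  rewrite add1n ltnNge (leqW ij) subSn //= nth_drop subnKC //.
  by rewrite /reorder (nth_map j) ?size_enum_ord // nth_ord_enum.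
rewrite add0n ij nth_take //.
by rewrite /reorder (nth_map j) ?size_enum_ord // nth_ord_enum.
Qed.

Section Unshuffles.
Variables (K : fieldType) (T : nmodType) (par : T -> bool) (W : lmodType K).

Definition psum (A : seq T) := odd (count par A).

(* The sum of [+/- G A B] over the splittings of [x] into complementary
   subsequences [A] and [B]; the recursion moves an entry that goes to [B] past
   the later entries that go to [A]. *)
Fixpoint unsh (G : seq T -> seq T -> W) (x : seq T) : W :=
  match x with
  | [::] => G [::] [::]
  | y :: x => unsh (fun A B => G (y :: A) B) x +
      unsh (fun A B => (-1) ^+ (par y && psum A) *: G A (y :: B)) x
  end.

Lemma psum_cons y A : psum (y :: A) = par y (+) psum A.
Proof. by rewrite /psum /= oddD oddb. Qed.

Lemma psum_cat A B : psum (A ++ B) = psum A (+) psum B.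
Proof. by rewrite /psum count_cat oddD. Qed.

Lemma eq_unsh G G' x :
  (forall A B, perm_eq (A ++ B) x -> G A B = G' A B) -> unsh G x = unsh G' x.
Proof.
elim: x G G' => [|y x IH] G G' h /=; first exact: h.
congr (_ + _); apply: IH => A B AB; first by apply: h; rewrite /= perm_cons.
by congr (_ *: _); apply: h; rewrite -cat1s perm_catCA /= perm_cons.
Qed.

Lemma unsh0 x : unsh (fun _ _ => 0) x = 0.
Proof.
elim: x => //= y x IH; rewrite IH add0r.
by rewrite -[RHS]IH; apply: eq_unsh => A B _; rewrite scaler0.
Qed.

Lemma unsh1 G x : (forall A B, perm_eq (A ++ B) x -> G A B = 0) -> unsh G x = 0.
Proof. by move=> h; rewrite -(unsh0 x); apply: eq_unsh. Qed.

Lemma unshD G G' x :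
  unsh (fun A B => G A B + G' A B) x = unsh G x + unsh G' x.
Proof.
elim: x G G' => //= y x IH G G'; rewrite IH addrACA; congr (_ + _).
by rewrite -IH; apply: eq_unsh => A B _; rewrite scalerDr.
Qed.

Lemma unshZ c G x : unsh (fun A B => c *: G A B) x = c *: unsh G x.
Proof.
elim: x G => //= y x IH G; rewrite scalerDr IH; congr (_ + _).
by rewrite -IH; apply: eq_unsh => A B _; rewrite !scalerA mulrC.
Qed.

Lemma unsh_sum n (G : nat -> seq T -> seq T -> W) x :
  unsh (fun A B => \sum_(i < n) G i A B) x = \sum_(i < n) unsh (G i) x.
Proof.
elim: n => [|n IH].
  by rewrite big_ord0; apply: unsh1 => A B _; rewrite big_ord0.
rewrite big_ord_recr /= -IH -unshD.
by apply: eq_unsh => A B _; rewrite big_ord_recr.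
Qed.

Lemma prod_parity (d : nat -> int) n (s : 'S_n) (x : seq T) (b : bool)
    (e : int) p :
  (p <= n)%N -> (forall i, (i < n)%N -> odd `|d i|%N = par x`_i) ->
  odd `|e|%N = b ->
  \prod_(k < n | (k < p)%N) (-1 : K) ^ (d (s k) * e) =
  (-1) ^+ (b && psum (take p (reorder s x))).
Proof.
move=> lp dx eb; pose F k : K := (-1) ^+ (b && par (reorder s x)`_k).
transitivity (\prod_(k < n | (k < p)%N) F k).
  apply: eq_bigr => k _; rewrite expN1z abszM oddM eb dx // andbC /F.
  by rewrite /reorder (nth_map k) ?size_enum_ord // nth_ord_enum.
rewrite -(big_ord_widen n F lp).
have : size (take p (reorder s x)) = p by rewrite size_takel ?size_reorder.
have : forall k, (k < p)%N ->
    F k = (-1) ^+ (b && par (take p (reorder s x))`_k).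
  by move=> k kp; rewrite nth_take.
move: (take p _) F => A; elim/last_ind: A p {lp} => [|A y IH] p F FE sA.
  by rewrite -sA big_ord0 /psum /= andbF.
rewrite size_rcons in sA; case: sA FE => <- FE.
rewrite big_ord_recr /= FE // nth_rcons ltnn eqxx -cats1 psum_cat andb_addr.
rewrite signr_addb /psum /= addn0 oddb; congr (_ * _); apply: IH => // k kA.
by rewrite FE ?nth_rcons ?kA // ltnW.
Qed.

(** The first entry heads either the first or the second block, which gives the two summands of
    [unsh]. In the second case it passes the whole first block, and this is the sign in the
    recursion. *)
Lemma shuffle_sum n p (d : nat -> int) (x : seq T) (G : seq T -> seq T -> W) :
  size x = n -> (p <= n)%N ->
  (forall i, (i < n)%N -> odd `|d i|%N = par x`_i) ->
  \sum_(s in shuffles n p) koszul K d s *: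
    G (take p (reorder s x)) (drop p (reorder s x)) =
  unsh (fun A B => if size A == p then G A B else 0) x.
Proof.
elim: x n p d G => [|y x IH] [|n] //= p d G.
  move=> _; rewrite leqn0 => /eqP -> _ /=.
  rewrite (big_pred1 1%g) => [|s].
    have -> : reorder (1%g : 'S_0) ([::] : seq T) = [::].
      by apply: size0nil; rewrite size_reorder.
    by rewrite /koszul big_ord0 scale1r.
  have -> : s = 1%g by apply/permP => -[].
  by rewrite /= eqxx; apply/shufflesP => -[].
case=> sx lp dx.
have dy : odd `|d 0%N|%N = par y by exact: (dx 0%N).
have dx' i : (i < n)%N -> odd `|d i.+1|%N = par x`_i.
  by move=> h; exact: (dx i.+1).
pose F (i : 'I_n.+1) := \sum_(s : 'S_n)
  if lift_perm i ord0 s \in shuffles n.+1 p then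
    koszul K d (lift_perm i ord0 s) *:
      G (take p (reorder (lift_perm i ord0 s) (y :: x)))
        (drop p (reorder (lift_perm i ord0 s) (y :: x)))
  else 0.
transitivity (\sum_i F i); first by rewrite big_mkcond; exact: sum_perm_lift.
have F0 (i : 'I_n.+1) : i <> p :> nat -> i <> ord0 -> F i = 0.
  move=> ip i0; rewrite /F big1 // => s _; case: ifP => // h.
  by case: i0; exact: lift_shufflesN h ip.
have F1 q : p = q.+1 -> F ord0 =
    unsh (fun A B => if size (y :: A) == p then G (y :: A) B else 0) x.
  move=> pq; rewrite pq ltnS in lp; rewrite /F pq.
  rewrite -(IH n q (fun k => d k.+1) (fun A B => G (y :: A) B)) //.
  rewrite [RHS]big_mkcond; apply: eq_bigr => s _; rewrite lift_shuffles0.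
  case: ifP => // _.
  by rewrite koszul_lift big_pred0 // mul1r reorder_lift take0 drop0.
have F2 (lp' : (p < n.+1)%N) : F (Ordinal lp') =
    unsh (fun A B => (-1) ^+ (par y && psum A) *:
      (if size A == p then G A (y :: B) else 0)) x.
  transitivity (unsh (fun A B => if size A == p then
      (-1) ^+ (par y && psum A) *: G A (y :: B) else 0) x); last first.
    by apply: eq_unsh => A B _; case: ifP; rewrite ?scaler0.
  rewrite -(IH n p (fun k => d k.+1)
    (fun A B => (-1) ^+ (par y && psum A) *: G A (y :: B))) //.
  rewrite [RHS]big_mkcond; apply: eq_bigr => s _; rewrite lift_shuffles1.
  case: ifP => // _; rewrite koszul_lift reorder_lift /=.
  rewrite (prod_parity s (d := fun k => d k.+1) (x := x) (b := par y)) //.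
  have st : size (take p (reorder s x)) = p.
    by rewrite size_takel // size_reorder.
  by rewrite take_size_cat // drop_size_cat // scalerA mulrC.
clearbody F; rewrite (bigD1 ord0) //=.
(* For [p = 0] the positions 0 and [p] coincide and only the second summand survives; for [p = n.+1]
   position [p] does not exist and only the first does. *)
case: p lp F0 F1 F2 => [|p] lp F0 F1 F2.
  rewrite big1 => [|i /eqP i0]; last first.
    by apply: F0 => // h; apply: i0; apply: val_inj.
  rewrite unsh1 // addr0 add0r -(F2 (ltn0Sn n)); congr F; exact: val_inj.
rewrite (F1 p) //; congr (_ + _).
case: (ltnP p.+1 n.+1) => lp'.
  rewrite -(F2 lp') (bigD1 (Ordinal lp')) //= big1 ?addr0 //.
  move=> i /andP[/eqP i0 /eqP ip].
  by apply: F0 => // h; apply: ip; apply: val_inj.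
rewrite big1 => [|i /eqP i0]; last first.
  by apply: F0 => // h; have := ltn_ord i; rewrite h ltnNge lp'.
rewrite unsh1 // => A B /perm_size; rewrite size_cat sx => h.
rewrite ltn_eqF ?scaler0 //; apply: leq_trans lp'; rewrite ltnS -h; exact: leq_addr.
Qed.
End Unshuffles.

Section UnshuffleMaps.
Variables (K : fieldType) (T : nmodType) (par : T -> bool) (W : lmodType K).

Lemma unsh_linear (W' : lmodType K) (f : {linear W -> W'}) G x :
  f (unsh par G x) = unsh par (fun A B => f (G A B)) x.
Proof.
elim: x G => //= y x IH G; rewrite linearD !IH; congr (_ + _).
by apply: eq_unsh => A B _; rewrite linearZ.
Qed.

Lemma unshC (G : seq T -> seq T -> W) x :
  unsh par G x =
  unsh par (fun A B => (-1) ^+ (psum par A && psum par B) *: G B A) x.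
Proof.
elim: x G => [|y x IH] G /=; first by rewrite scale1r.
rewrite addrC IH (IH (fun A B => G (y :: A) B)); congr (_ + _).
  apply: eq_unsh => A B _; rewrite psum_cons.
  by rewrite scalerA -signr_addb; congr ((-1) ^+ _ *: _);
    case: (par y); case: (psum par A); case: (psum par B).
apply: eq_unsh => A B _; rewrite psum_cons.
by rewrite scalerA -signr_addb; congr ((-1) ^+ _ *: _);
  case: (par y); case: (psum par A); case: (psum par B).
Qed.
Lemma unsh_pair (W' : lmodType K) (G : seq T -> seq T -> W)
    (G' : seq T -> seq T -> W') x :
  unsh par (fun A B => (G A B, G' A B)) x = (unsh par G x, unsh par G' x).
Proof. by elim: x G G' => //= y x IH G G'; rewrite !IH. Qed.
End UnshuffleMaps.

(** Apply [sum_perm_lift] to the indicator of [s]: the total is 1, so some term on the right is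
    nonzero. *)
Lemma lift_perm_inv n (s : 'S_n.+1) :
  exists i s', s = lift_perm i ord0 s'.
Proof.
pose F t : nat := t == s.
have : \sum_t F t = 1%N.
  by rewrite (bigD1 s) //= {1}/F eqxx big1 // => t; rewrite /F => /negPf ->.
rewrite sum_perm_lift.
case: (pselect (exists i s', s = lift_perm i ord0 s')) => // h.
rewrite big1 // => i _; rewrite big1 // => s' _; rewrite /F.
by case: eqP => // e; case: h; exists i, s'.
Qed.

(** Lets the signed shuffles in [diamond] be treated as Koszul-signed ones, with all entries odd. *)
Lemma koszul_odd (K : fieldType) n (s : 'S_n) :
  koszul K (fun=> 1) s = (-1) ^+ odd_perm s.
Proof.
elim: n s => [|n IH] s.
  have -> : s = 1%g by apply/permP => -[].
  by rewrite odd_perm1 /koszul big_ord0.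
have [i [s' ->]] := lift_perm_inv s.
rewrite koszul_lift IH odd_lift_perm /= addbF signr_addb; congr (_ * _).
have le_i : (i <= n)%N by rewrite -ltnS.
rewrite -(big_ord_widen n (fun=> (-1 : K) ^ (1 * 1)) le_i).
by rewrite mulr1 big_const_ord iter_mulr_1 signr_odd.
Qed.

Lemma perm_reorder (T : nmodType) n (s : 'S_n) (x : seq T) :
  size x = n -> perm_eq (reorder s x) x.
Proof.
elim: x n s => [|y x IH] [|n] s //=.
  by move=> _; rewrite (size0nil (size_reorder s _)).
case=> sx; have [i [s' ->]] := lift_perm_inv s.
by rewrite reorder_lift -cat1s perm_catCA /= perm_cons cat_take_drop IH.
Qed.

Lemma map_reorder (T T' : nmodType) (f : T -> T') n (s : 'S_n) (x : seq T) :
  size x = n -> map f (reorder s x) = reorder s (map f x).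
Proof.
move=> sx; rewrite /reorder -map_comp; apply: eq_map => k /=.
by rewrite (nth_map 0) // sx.
Qed.

(** * Graded symmetry from adjacent transpositions *)

Section GradedSymmetric.
Variables (K : fieldType) (T : nmodType) (par : T -> bool) (W : lmodType K).
Variable (Q : T -> Prop).

Definition gsym (f : seq T -> W) := forall w y z v,
  (forall t, t \in w ++ y :: z :: v -> Q t) ->
  f (w ++ y :: z :: v) = (-1) ^+ (par y && par z) *: f (w ++ z :: y :: v).

Lemma gsym_cons f y : Q y -> gsym f -> gsym (fun x => f (y :: x)).
Proof.
move=> Qy fs w u v x Qx; apply: (fs (y :: w)) => t.
by rewrite inE => /orP[/eqP ->//|]; exact: Qx.
Qed.

Lemma gsym_front f A y B : gsym f -> (forall t, t \in A ++ y :: B -> Q t) ->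
  f (A ++ y :: B) = (-1) ^+ (par y && psum par A) *: f (y :: A ++ B).
Proof.
elim: A f => [|a A IH] f fs QA; first by rewrite andbF scale1r.
have Qa : Q a by apply: QA; rewrite mem_head.
have QA' t : t \in A ++ y :: B -> Q t.
  by move=> h; apply: QA; rewrite inE h orbT.
rewrite (IH _ (gsym_cons Qa fs)) // (fs [::]) => [|t]; last first.
  rewrite !inE => /or3P[/eqP->|/eqP->|h] //; apply: QA'.
    by rewrite mem_cat inE eqxx orbT.
  by move: h; rewrite !mem_cat inE => /orP[] ->; rewrite ?orbT.
by rewrite scalerA -signr_addb psum_cons andb_addr [par y && par a]andbC addbC.
Qed.

(** Bringing the first entry back to the front costs the first factor of [koszul_lift]; the
    induction then applies to [f] with that entry fixed. *)
Lemma gsym_reorder f n (d : nat -> int) (s : 'S_n) (x : seq T) : gsym f ->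
  size x = n -> (forall t, t \in x -> Q t) ->
  (forall i, (i < n)%N -> odd `|d i|%N = par x`_i) ->
  f (reorder s x) = koszul K d s *: f x.
Proof.
elim: x f n d s => [|y x IH] f [|n] d s //= fs.
  by move=> _ _ _; rewrite (size0nil (size_reorder s _)) /koszul big_ord0 scale1r.
case=> sx Qx dx; have [i [s' ->]] := lift_perm_inv s.
have Qy : Q y by apply: Qx; rewrite mem_head.
have Qx' t : t \in x -> Q t by move=> h; apply: Qx; rewrite inE h orbT.
rewrite reorder_lift (gsym_front fs) => [|t]; last first.
  rewrite -cat1s (perm_mem (permEl (perm_catCA _ _ _))) cat_take_drop inE.
  case/orP=> [/eqP->//|].
  by rewrite (perm_mem (perm_reorder s' sx)); exact: Qx'.
rewrite cat_take_drop (IH (fun x => f (y :: x)) n (fun k => d k.+1)) //; first last.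
- by move=> k kn; exact: (dx k.+1).
- exact: gsym_cons.
rewrite koszul_lift scalerA; congr (_ * _ *: _); apply/esym.
apply: (prod_parity K s' (d := fun k => d k.+1) (x := x) (b := par y)).
- by rewrite -ltnS.
- by move=> k kn; exact: (dx k.+1).
- exact: (dx 0%N).
Qed.
End GradedSymmetric.

(** * Linear combinations *)

Section LinearCombinations.
Variables (K : pzRingType) (V : lmodType K).

Inductive lincomb :=
  | LVar of nat
  | LZero
  | LOpp of lincomb
  | LAdd of lincomb & lincomb
  | LScale of K & lincomb.

Fixpoint lc_eval (env : seq V) e : V :=
  match e with
  | LVar n => env`_n
  | LZero => 0
  | LOpp a => - lc_eval env a
  | LAdd a b => lc_eval env a + lc_eval env b
  | LScale c a => c *: lc_eval env a
  end.

Fixpoint lc_coef e (n : nat) : K :=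
  match e with
  | LVar m => if m == n then 1 else 0
  | LZero => 0
  | LOpp a => - lc_coef a n
  | LAdd a b => lc_coef a n + lc_coef b n
  | LScale c a => c * lc_coef a n
  end.

Fixpoint lc_agree n e f : Prop :=
  if n is m.+1 then lc_coef e m = lc_coef f m /\ lc_agree m e f else True.

Lemma lc_evalE env e :
  lc_eval env e = \sum_(i < size env) lc_coef e i *: env`_i.
Proof.
elim: e => /= [n||a ->|a -> b ->|c a ->].
- case: (ltnP n (size env)) => h.
    rewrite (bigD1 (Ordinal h)) //= eqxx scale1r big1 ?addr0 // => i /eqP ni.
    by case: eqP => [e|]; rewrite ?scale0r //; case: ni; apply: val_inj.
  rewrite nth_default // big1 // => i _.
  by rewrite gtn_eqF ?scale0r // (leq_trans (ltn_ord i)).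
- by rewrite big1 // => i _; rewrite scale0r.
- by rewrite -sumrN; apply: eq_bigr => i _; rewrite scaleNr.
- by rewrite -big_split; apply: eq_bigr => i _; rewrite scalerDl.
- by rewrite scaler_sumr; apply: eq_bigr => i _; rewrite scalerA.
Qed.

Lemma lc_eq env e f :
  lc_agree (size env) e f -> lc_eval env e = lc_eval env f.
Proof.
move=> h; rewrite !lc_evalE; apply: eq_bigr => i _; congr (_ *: _).
elim: (size env) h i => [|n IH] /=; first by move=> _ [].
case=> hn h i; have := ltn_ord i.
rewrite ltnS leq_eqVlt => /orP[/eqP->//|lt_in].
exact: (IH h (Ordinal lt_in)).
Qed.
End LinearCombinations.

Ltac lc_index x l :=
  lazymatch l with
  | x :: _ => constr:(0%N)
  | _ :: ?t => let n := lc_index x t in constr:(S n)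
  end.

Ltac lc_insert x l :=
  lazymatch l with
  | context [x :: _] => l
  | _ => constr:(x :: l)
  end.

Ltac lc_atoms t l :=
  lazymatch t with
  | 0 => l
  | ?a + ?b => let l' := lc_atoms a l in lc_atoms b l'
  | - ?a => lc_atoms a l
  | _ *: ?a => lc_atoms a l
  | _ => lc_insert t l
  end.

Ltac lc_reify K t l :=
  lazymatch t with
  | 0 => constr:(@LZero K)
  | ?a + ?b => let e := lc_reify K a l in let f := lc_reify K b l in
      constr:(LAdd e f)
  | - ?a => let e := lc_reify K a l in constr:(LOpp e)
  | ?c *: ?a => let e := lc_reify K a l in constr:(LScale c e)
  | _ => let n := lc_index t l in constr:(@LVar K n)
  end.

(* Decides an equality between two linear combinations of the same vectors,
   by comparing coefficients with [ring]. *)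
Ltac lincomb K :=
  lazymatch goal with
  | |- ?a = ?b :> ?V =>
    let l := lc_atoms a (@nil V) in
    let l := lc_atoms b l in
    let e := lc_reify K a l in
    let f := lc_reify K b l in
    apply: (@lc_eq _ _ l e f); rewrite /=; repeat split; ring
  end.

Ltac bool_atom e :=
  lazymatch e with
  | ?a && _ => bool_atom a
  | ?a (+) _ => bool_atom a
  | ~~ ?a => bool_atom a
  | true => fail
  | false => fail
  | _ => e
  end.

(** Sign exponents are Boolean expressions in finitely many parities, so identities between signed
    sums are checked case by case. *)
Ltac signs K :=
  repeat match goal with |- context [(-1) ^+ nat_of_bool ?e] =>
    let b := bool_atom e in case: (b) => /= end;
  lincomb K.

(** * The pre-Lie identity *)

Section Insertion.
Variables (K : fieldType) (E : lmodType K).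
Implicit Types (f g h : seq E -> E) (x z : seq E) (y : E) (b c : bool).

Definition deriv f y z := f (y :: z).

(** A component of arity n has degree n - 1, so this is the grading involution f |-> (-1)^{|f|} f;
    it is linear and makes sense without a fixed degree. *)
Definition twist f z := (-1 : K) ^+ (size z).+1 *: f z.

(* The terms of [ins f g x] are those of [f <> g], summed over the position
   of the last argument of [g] and the set of the other ones. *)
Fixpoint ins f g x : E :=
  match x with
  | [::] => 0
  | y :: x => f (g [:: y] :: x) + ins (deriv f y) (twist g) x
              + ins f (deriv g y) x
  end.

(** The shift between arity and degree matters here: vanishing on arities of parity [b] means that
    [f] lives in degrees of parity [b]. *)
Definition parity b f := forall z, odd (size z) = b -> f z = 0.

Lemma deriv_multilinear f y : multilinear f -> multilinear (deriv f y).
Proof. by move=> fM s1 s2 a u v; exact: (fM (y :: s1)). Qed.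

Lemma twist_multilinear f : multilinear f -> multilinear (twist f).
Proof.
move=> fM s1 s2 a u v; rewrite /twist fM !size_cat /= scalerDr !scalerA.
by rewrite mulrC.
Qed.

Lemma multilinearZ f s1 s2 a u :
  multilinear f -> f (s1 ++ a *: u :: s2) = a *: f (s1 ++ u :: s2).
Proof. by move=> fM; rewrite -[a *: u]addr0 fM multilinear0 ?addr0. Qed.

Lemma parity_deriv b f y : parity b f -> parity (~~ b) (deriv f y).
Proof. by move=> pf z zb; apply: pf; rewrite /= zb negbK. Qed.

Lemma twistE b f : parity b f -> twist f = fun z => (-1) ^+ b *: f z.
Proof.
move=> pf; apply/funext => z; rewrite /twist -(signr_odd _ (size z).+1) /=.
case: (eqVneq (odd (size z)) b) => [/pf ->|]; first by rewrite !scaler0.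
by case: b {pf}; case: (odd _).
Qed.

Lemma ins_lin f f' g a x :
  ins (fun z => a *: f z + f' z) g x = a *: ins f g x + ins f' g x.
Proof.
elim: x f f' g => [|y x IH] f f' g /=; first by rewrite scaler0 addr0.
have dE h h' : deriv (fun z => a *: h z + h' z) y =
    fun z => a *: deriv h y z + deriv h' y z by [].
by rewrite dE !IH; lincomb K.
Qed.

Lemma ins0 g x : ins (fun=> 0) g x = 0.
Proof. by elim: x g => //= y x IH g; rewrite /deriv !IH !addr0. Qed.

Lemma ins_linr f g g' a x : multilinear f ->
  ins f (fun z => a *: g z + g' z) x = a *: ins f g x + ins f g' x.
Proof.
elim: x f g g' => [|y x IH] f g g' fM /=; first by rewrite scaler0 addr0.
have dE : deriv (fun z => a *: g z + g' z) y =
    fun z => a *: deriv g y z + deriv g' y z by [].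
rewrite (fM [::]) dE IH //=.
have -> : twist (fun z => a *: g z + g' z) =
    fun z => a *: twist g z + twist g' z.
  by apply/funext => z; rewrite /twist scalerDr !scalerA mulrC.
by rewrite IH; [lincomb K | exact: deriv_multilinear].
Qed.

Lemma insZl f g a x : ins (fun z => a *: f z) g x = a *: ins f g x.
Proof.
rewrite -[RHS]addr0 -(ins0 g x) -ins_lin.
by congr ins; apply/funext => z; rewrite addr0.
Qed.

Lemma insDl f f' g x : ins (fun z => f z + f' z) g x = ins f g x + ins f' g x.
Proof.
rewrite -[ins f g x]scale1r -ins_lin.
by congr ins; apply/funext => z; rewrite scale1r.
Qed.

Lemma ins0r f x : multilinear f -> ins f (fun=> 0) x = 0.
Proof.
move=> fM; have := ins_linr (fun=> 0) (fun=> 0) (-1) x fM.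
have -> : (fun=> -1 *: 0 + 0) = (fun=> 0) :> (seq E -> E).
  by apply/funext => z; rewrite scaler0 add0r.
by rewrite scaleN1r addNr.
Qed.

Lemma insZr f g a x : multilinear f -> ins f (fun z => a *: g z) x = a *: ins f g x.
Proof.
move=> fM; rewrite -[RHS]addr0 -(ins0r x fM) -ins_linr //.
by congr ins; apply/funext => z; rewrite addr0.
Qed.

Lemma insDr f g g' x : multilinear f ->
  ins f (fun z => g z + g' z) x = ins f g x + ins f g' x.
Proof.
move=> fM; rewrite -[ins f g x]scale1r -ins_linr //.
by congr ins; apply/funext => z; rewrite scale1r.
Qed.

Lemma ins_cons b f g y x : multilinear f -> parity b g ->
  ins f g (y :: x) = f (g [:: y] :: x) + (-1) ^+ b *: ins (deriv f y) g x
    + ins f (deriv g y) x.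
Proof.
by move=> fM pg; rewrite /= (twistE pg) insZr //; exact: deriv_multilinear.
Qed.

Lemma ins_multilinear f g : multilinear f -> multilinear g -> multilinear (ins f g).
Proof.
move=> fM gM s1; elim: s1 f g fM gM => [|y s1 IH] f g fM gM s2 a u v /=.
  rewrite (gM [::] [::]) (fM [::]).
  have -> : deriv f (a *: u + v) = fun z => a *: deriv f u z + deriv f v z.
    by apply/funext => z; exact: (fM [::]).
  have -> : deriv g (a *: u + v) = fun z => a *: deriv g u z + deriv g v z.
    by apply/funext => z; exact: (gM [::]).
  by rewrite ins_lin ins_linr //=; lincomb K.
rewrite (fM (_ :: s1)) !IH; [by rewrite /=; lincomb K|..];
  by [|exact: deriv_multilinear|exact: twist_multilinear].
Qed.

Lemma ins_parity b c f g : multilinear f -> parity b f -> parity c g ->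
  parity (b (+) c) (ins f g).
Proof.
move=> fM pf pg z; elim: z b c f g fM pf pg => //= y z IH b c f g fM pf pg zbc.
rewrite (twistE pg) insZr; last exact: deriv_multilinear.
rewrite (IH (~~ b) c) //; first last.
- by rewrite -[odd _]negbK zbc; case: b {pf zbc}; case: c {pg}.
- exact: parity_deriv.
- exact: deriv_multilinear.
rewrite (IH b (~~ c)) //; first last.
- by rewrite -[odd _]negbK zbc; case: b {pf zbc}; case: c {pg}.
- exact: parity_deriv.
(* An odd [g] has no component of arity 1, so [g [:: y]] vanishes; for an even [g] it is [f] that
   vanishes, by its arity. *)
rewrite scaler0 !addr0; case: c pg zbc => pg zbc; last first.
  by apply: pf => /=; rewrite zbc addbF.
by rewrite pg // (multilinear0 [::]).
Qed.

Definition assoc f g h x := ins (ins f g) h x - ins f (ins g h) x.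

(** The terms [f (g [:: h [:: y]] :: x)] cancel. What remains are associators on the shorter list
    and the terms in which [y] alone is plugged into [g] or [h], and the result into [f]. *)
Lemma assoc_cons b c f g h y x :
  multilinear f -> multilinear g -> multilinear h -> parity b g -> parity c h ->
  assoc f g h (y :: x) =
    (-1) ^+ b *: ins (deriv f (h [:: y])) g x
    + (-1) ^+ c *: ins (deriv f (g [:: y])) h x
    + (-1) ^+ (b (+) c) *: assoc (deriv f y) g h x
    + assoc f g (deriv h y) x + (-1) ^+ c *: assoc f (deriv g y) h x.
Proof.
move=> fM gM hM pg ph; rewrite /assoc.
rewrite (ins_cons _ _ (ins_multilinear fM gM) ph).
rewrite (ins_cons _ _ fM (ins_parity gM pg ph)).
have -> : deriv (ins f g) y = fun z => deriv f (g [:: y]) z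
    + ((-1) ^+ b *: ins (deriv f y) g z + ins f (deriv g y) z).
  by apply/funext => z; rewrite /deriv -/(deriv f y) (ins_cons _ _ fM pg) addrA.
have -> : deriv (ins g h) y = fun z => deriv g (h [:: y]) z
    + ((-1) ^+ c *: ins (deriv g y) h z + ins g (deriv h y) z).
  by apply/funext => z; rewrite /deriv -/(deriv g y) (ins_cons _ _ gM ph) addrA.
rewrite !insDl !insZl !insDr // !insZr // (ins_cons _ _ fM pg) /= addr0 addr0.
by rewrite signr_addb; lincomb K.
Qed.

(** This is the graded right pre-Lie identity. The recursion of [assoc_cons] is symmetric in [g] and
    [h] up to sign, so induction on the list suffices. *)
Lemma assoc_sym b c f g h x :
  multilinear f -> multilinear g -> multilinear h -> parity b g -> parity c h ->
  assoc f g h x = (-1) ^+ (b && c) *: assoc f h g x.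
Proof.
elim: x b c f g h => [|y x IH] b c f g h fM gM hM pg ph.
  by rewrite /assoc /= subrr scaler0.
have fM' := deriv_multilinear y fM.
have gM' := deriv_multilinear y gM; have hM' := deriv_multilinear y hM.
rewrite (assoc_cons y x fM gM hM pg ph) (assoc_cons y x fM hM gM ph pg).
rewrite (IH b c (deriv f y)) // (IH b (~~ c) f g (deriv h y)) //; last exact: parity_deriv.
rewrite (IH (~~ b) c f (deriv g y) h) //; last exact: parity_deriv.
case: b pg => pg; case: c ph => ph /=; try by lincomb K.
(* For odd [g] and [h] the two terms outside the associators carry the wrong sign, but they vanish
   because [g [:: y]] and [h [:: y]] are components of degree 0. *)
have d0 : deriv f 0 = fun=> 0 by apply/funext => z; rewrite /deriv (multilinear0 [::]).
by rewrite pg // ph // d0 !ins0; lincomb K.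
Qed.
End Insertion.

(** * Comparison of the diamond product with recursive insertion *)

Section DiamondInsertion.
Variables (K : fieldType) (E : lmodType K).
Implicit Types (f g h : seq E -> E) (x : seq E) (b c : bool).

Let odd_deg : E -> bool := fun=> true.

Lemma psum_odd_deg (A : seq E) : psum odd_deg A = odd (size A).
Proof. by rewrite /psum count_predT. Qed.

Lemma reorder_take n (s : 'S_n) x : reorder s x = reorder s (take n x).
Proof. by apply: eq_map => k; rewrite nth_take. Qed.

(** The part of f <> g in which entry [k] is the last argument of [g]: [A] collects the earlier
    arguments of [f], [B] the other arguments of [g], and the power of -1 is the factor
    (-1)^{(i-1)n} of the Balavoine bracket. *)
Definition ins_at f g x k : E :=
  unsh odd_deg (fun A B => (-1 : K) ^+ (size A * size B) *:
    f (A ++ g (B ++ [:: x`_k]) :: drop k.+1 x)) (take k x).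

(** Both sides run over the pairs (j, n) with j + n < N; on the right they are grouped by k = j + n,
    the index of the last argument of [g]. *)
Lemma sum_triangle (T : nat -> nat -> E) N :
  \sum_(m < N) \sum_(j < m.+1) T j (N.-1 - m)%N =
  \sum_(k < N) \sum_(j < k.+1) T j (k - j)%N.
Proof.
case: N => [|N]; first by rewrite !big_ord0.
elim: N => [|N IH]; first by rewrite !big_ord_recl !big_ord0 /= !addr0.
rewrite [RHS]big_ord_recr -IH big_ord_recl /=.
rewrite [X in _ = _ + X]big_ord_recl big_ord1 !subn0 [RHS]addrC -addrA.
congr (_ + _); rewrite addrC -big_split /=; apply: eq_bigr => m _.
by rewrite [LHS]big_ord_recr /= /bump /= !add1n !subSS.
Qed.

Lemma diamond_term f g x j n : (j + n < size x)%N ->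
  (-1 : K) ^+ (j * n) *: \sum_(s in Sh j n) (-1 : K) ^+ odd_perm s *:
     f (take j (reorder s x) ++ g (drop j (reorder s x) ++ [:: x`_(j + n)]) ::
        drop (j + n).+1 x) =
  unsh odd_deg (fun A B => if size A == j then (-1 : K) ^+ (size A * size B) *:
    f (A ++ g (B ++ [:: x`_(j + n)]) :: drop (j + n).+1 x) else 0) (take (j + n) x).
Proof.
move=> jn; have sx : size (take (j + n) x) = (j + n)%N by rewrite size_takel // ltnW.
rewrite -(@shuffle_sum _ _ _ _ _ j (fun=> 1) _ _ sx) ?leq_addr // scaler_sumr.
apply: eq_bigr => s _; rewrite koszul_odd scalerA mulrC -scalerA reorder_take.
rewrite size_drop size_reorder addKn size_takel ?size_reorder ?leq_addr //.
Qed.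

Lemma sum_diamond f g x :
  \sum_(m < size x) diamond m ((size x).-1 - m) f g x =
  \sum_(k < size x) ins_at f g x k.
Proof.
rewrite /diamond; pose T j n := (-1 : K) ^+ (j * n) *:
  \sum_(s in Sh j n) (-1 : K) ^+ odd_perm s *:
     f (take j (reorder s x) ++ g (drop j (reorder s x) ++ [:: x`_(j + n)]) ::
        drop (j + n).+1 x).
rewrite (sum_triangle T); apply: eq_bigr => k _; rewrite /ins_at.
transitivity (unsh odd_deg (fun A B => \sum_(j < k.+1) if size A == j then
    (-1 : K) ^+ (size A * size B) *:
    f (A ++ g (B ++ [:: x`_k]) :: drop k.+1 x) else 0) (take k x)).
  rewrite (unsh_sum _ _ (fun j A B => if size A == j then
    (-1 : K) ^+ (size A * size B) *:
    f (A ++ g (B ++ [:: x`_k]) :: drop k.+1 x) else 0)).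
  apply: eq_bigr => j _; have jk : (j + (k - j))%N = k by rewrite subnKC // -ltnS.
  have jx : (j + (k - j) < size x)%N by rewrite jk.
  by apply: etrans (diamond_term f g jx) _; rewrite jk.
apply: eq_unsh => A B /perm_size; rewrite size_cat size_takel ?[(k <= _)%N]ltnW // => AB.
have Ak : (size A < k.+1)%N by rewrite ltnS -AB leq_addr.
rewrite (bigD1 (Ordinal Ak)) //= eqxx big1 ?addr0 // => i /eqP iA.
by case: eqP => // e; case: iA; apply: val_inj.
Qed.

(** An entry added to [A] changes (-1)^{|A||B|} by (-1)^{|B|}, which is the sign of [twist g]; an
    entry added to [B] changes it by (-1)^{|A|}, which cancels the unshuffle sign. *)
Lemma ins_atS f g y x k : multilinear f ->
  ins_at f g (y :: x) k.+1 =
  ins_at (deriv f y) (twist g) x k + ins_at f (deriv g y) x k.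
Proof.
move=> fM; rewrite /ins_at /=; congr (_ + _); apply: eq_unsh => A B _.
  rewrite /twist (multilinearZ _ _ _ _ (deriv_multilinear y fM)) scalerA.
  rewrite -exprD size_cat addn1 /= mulSn addnC -[in RHS]signr_odd.
  by rewrite oddD /= negbK -oddD signr_odd.
rewrite psum_odd_deg /= scalerA -[(-1) ^+ (_ * _)%N]signr_odd /= mulnS oddD.
by rewrite -signr_addb addKb signr_odd.
Qed.

Lemma sum_ins_at f g x : multilinear f ->
  \sum_(k < size x) ins_at f g x k = ins f g x.
Proof.
elim: x f g => [|y x IH] f g fM /=; first by rewrite big_ord0.
rewrite big_ord_recl /= -(IH _ _ (deriv_multilinear y fM)) -(IH f) // -addrA.
rewrite -big_split /=.
congr (_ + _); last by apply: eq_bigr => k _; rewrite ins_atS.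
by rewrite /ins_at /= muln0 scale1r drop0.
Qed.

Lemma diamond_parity b c f g m n x :
  multilinear f -> parity b f -> parity c g ->
  size x = (m + n).+1 -> (odd m != b) || (odd n != c) -> diamond m n f g x = 0.
Proof.
move=> fM pf pg sx ne; rewrite /diamond big1 // => j _.
have jm : (j <= m)%N by rewrite -ltnS.
rewrite big1 ?scaler0 // => s _; have szr := size_reorder s x.
case/orP: ne => ne.
  rewrite pf ?scaler0 // size_cat /= size_takel ?szr ?leq_addr // size_drop sx.
  rewrite subSS subnDr addnS subnKC //=.
  by move: ne; case: b {pf}; case: odd.
rewrite pg ?(multilinear0 _ _ fM) ?scaler0 // size_cat size_drop szr addKn addn1 /=.
by move: ne; case: c {pg}; case: odd.
Qed.

Lemma bracket_funE b c f g x :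
  multilinear f -> multilinear g -> parity b f -> parity c g ->
  bracket_fun f g x = ins f g x - (-1) ^+ (b && c) *: ins g f x.
Proof.
move=> fM gM pf pg; rewrite -!sum_ins_at // -!sum_diamond.
(* Reversing the index exchanges m and n in the second sum, so that the summands can be compared one
   by one; those of the wrong parities vanish on both sides. *)
rewrite [X in _ = _ - _ *: X](reindex_inj rev_ord_inj) /= scaler_sumr -sumrB.
apply: eq_bigr => -[m lm] _ /=.
have e1 : ((size x).-1 - (size x - m.+1) = m)%N.
  by case: (size x) lm => // N lm; rewrite subSS subKn.
have e2 : (size x - m.+1 = (size x).-1 - m)%N by case: (size x) lm.
rewrite e1 e2; set n := ((size x).-1 - m)%N.
have sx : size x = (m + n).+1.
  by rewrite /n; case: (size x) lm => // N lm; rewrite subnKC.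
have sx' : size x = (n + m).+1 by rewrite addnC.
case: (boolP ((odd m != b) || (odd n != c))) => ne.
  rewrite (diamond_parity fM pf pg sx ne) (diamond_parity gM pg pf sx') ?scaler0 //.
  by rewrite orbC.
by move: ne; rewrite negb_or !negbK => /andP[/eqP<- /eqP<-]; rewrite -oddM signr_odd.
Qed.
End DiamondInsertion.

(** * The graded Lie algebra of cochains *)

Section BracketAlgebra.
Variables (K : fieldType) (E : lmodType K).
Implicit Types (X Y Z : cochain E) (b c : bool).

Definition cpar b X := parity b (\val X).

Lemma cochain_eq X Y : (forall x, \val X x = \val Y x) -> X = Y.
Proof. by move=> h; apply: val_inj; apply/funext. Qed.

Lemma cochain_mul X : multilinear (\val X).
Proof. by have [] := subP X. Qed.

Lemma diamond_linl m n (f f' g : seq E -> E) a x :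
  diamond m n (a *: f + f') g x = a *: diamond m n f g x + diamond m n f' g x.
Proof.
rewrite /diamond scaler_sumr -big_split /=; apply: eq_bigr => j _.
rewrite scalerA mulrC -scalerA -scalerDr; congr (_ *: _).
rewrite scaler_sumr -big_split /=; apply: eq_bigr => s _.
by rewrite scalerA mulrC -scalerA -scalerDr.
Qed.

Lemma diamond_linr m n (f g g' : seq E -> E) a x : multilinear f ->
  diamond m n f (a *: g + g') x = a *: diamond m n f g x + diamond m n f g' x.
Proof.
move=> fM; rewrite /diamond scaler_sumr -big_split /=; apply: eq_bigr => j _.
rewrite scalerA mulrC -scalerA -scalerDr; congr (_ *: _).
rewrite scaler_sumr -big_split /=; apply: eq_bigr => s _.
by rewrite scalerA mulrC -scalerA -scalerDr -fM.
Qed.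

Lemma bracket_linl a X X' Y :
  bracket (a *: X + X') Y = a *: bracket X Y + bracket X' Y.
Proof.
apply: cochain_eq => x.
change (bracket_fun (a *: \val X + \val X') (\val Y) x =
  a *: bracket_fun (\val X) (\val Y) x + bracket_fun (\val X') (\val Y) x).
rewrite /bracket_fun scaler_sumr -big_split /=; apply: eq_bigr => m _ /=.
rewrite diamond_linl diamond_linr; last exact: cochain_mul.
set A := diamond _ _ _ _ _; set B := diamond _ _ _ _ _.
set C := diamond _ _ _ _ _; set D := diamond _ _ _ _ _.
by lincomb K.
Qed.

Lemma bracket_linr a X Y Y' :
  bracket X (a *: Y + Y') = a *: bracket X Y + bracket X Y'.
Proof.
apply: cochain_eq => x.
change (bracket_fun (\val X) (a *: \val Y + \val Y') x =
  a *: bracket_fun (\val X) (\val Y) x + bracket_fun (\val X) (\val Y') x).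
rewrite /bracket_fun scaler_sumr -big_split /=; apply: eq_bigr => m _ /=.
rewrite diamond_linl diamond_linr; last exact: cochain_mul.
set A := diamond _ _ _ _ _; set B := diamond _ _ _ _ _.
set C := diamond _ _ _ _ _; set D := diamond _ _ _ _ _.
by lincomb K.
Qed.

Lemma bracketE b c X Y x : cpar b X -> cpar c Y ->
  \val (bracket X Y) x =
    ins (\val X) (\val Y) x - (-1) ^+ (b && c) *: ins (\val Y) (\val X) x.
Proof. by move=> pX pY; apply: bracket_funE => //; exact: cochain_mul. Qed.

Lemma cpar_bracket b c X Y :
  cpar b X -> cpar c Y -> cpar (b (+) c) (bracket X Y).
Proof.
move=> pX pY x hx; rewrite (bracketE _ pX pY).
rewrite (ins_parity (cochain_mul X) pX pY hx).
by rewrite addbC in hx; rewrite (ins_parity (cochain_mul Y) pY pX hx) scaler0 subr0.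
Qed.

Lemma bracket_anti b c X Y : cpar b X -> cpar c Y ->
  bracket X Y = - ((-1) ^+ (b && c) *: bracket Y X).
Proof.
move=> pX pY; apply: cochain_eq => x.
change (\val (bracket X Y) x = - ((-1) ^+ (b && c) *: \val (bracket Y X) x)).
rewrite (bracketE _ pX pY) (bracketE _ pY pX).
by case: b {pX}; case: c {pY} => /=; lincomb K.
Qed.

Lemma bracket_jacobi b c d X Y Z : cpar b X -> cpar c Y -> cpar d Z ->
  bracket (bracket X Y) Z =
    bracket X (bracket Y Z) + (-1) ^+ (c && d) *: bracket (bracket X Z) Y.
Proof.
move=> pX pY pZ; apply: cochain_eq => x.
change (\val (bracket (bracket X Y) Z) x = \val (bracket X (bracket Y Z)) x
  + (-1) ^+ (c && d) *: \val (bracket (bracket X Z) Y) x).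
have pXY := cpar_bracket pX pY; have pYZ := cpar_bracket pY pZ.
have pXZ := cpar_bracket pX pZ.
have valE b' c' X' Y' : cpar b' X' -> cpar c' Y' -> \val (bracket X' Y') =
    fun x => ins (\val X') (\val Y') x
             + - (-1) ^+ (b' && c') *: ins (\val Y') (\val X') x.
  by move=> p p'; apply/funext => z; rewrite (bracketE _ p p') scaleNr.
have XM := cochain_mul X; have YM := cochain_mul Y; have ZM := cochain_mul Z.
rewrite (bracketE _ pXY pZ) (bracketE _ pX pYZ) (bracketE _ pXZ pY).
rewrite (valE _ _ _ _ pX pY) (valE _ _ _ _ pY pZ) (valE _ _ _ _ pX pZ).
rewrite !insDl !insDr // !insZl !insZr //.
(* After every left-nested insertion is replaced by an associator plus a right-nested one, the
   right-nested terms cancel and the six associators cancel in pairs by [assoc_sym]. *)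
have sub f g h : ins (ins f g) h x = assoc f g h x + ins f (ins g h) x.
  by rewrite /assoc subrK.
rewrite !sub (assoc_sym x XM YM ZM pY pZ) (assoc_sym x YM XM ZM pX pZ).
rewrite (assoc_sym x ZM XM YM pX pY).
by case: b {pX pXY pXZ}; case: c {pY pYZ}; case: d {pZ} => /=; lincomb K.
Qed.
End BracketAlgebra.

(** * Higher derived brackets *)

Section HigherDerivedBrackets.
Variables (K : fieldType) (L : lmodType K) (br : L -> L -> L).
Variables (hom : bool -> L -> Prop) (P : {linear L -> L}).
Hypothesis br_linl : forall c X X' Y, br (c *: X + X') Y = c *: br X Y + br X' Y.
Hypothesis br_linr : forall c X Y Y', br X (c *: Y + Y') = c *: br X Y + br X Y'.
Hypothesis hom_lin : forall b c X Y, hom b X -> hom b Y -> hom b (c *: X + Y).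
Hypothesis hom0 : forall b, hom b 0.
Hypothesis hom_br : forall b c X Y, hom b X -> hom c Y -> hom (b (+) c) (br X Y).
Hypothesis br_anti : forall b c X Y, hom b X -> hom c Y ->
  br X Y = - ((-1) ^+ (b && c) *: br Y X).
Hypothesis br_jacobi : forall b c d X Y Z, hom b X -> hom c Y -> hom d Z ->
  br (br X Y) Z = br X (br Y Z) + (-1) ^+ (c && d) *: br (br X Z) Y.
Hypothesis hom_P : forall b X, hom b X -> hom b (P X).
Hypothesis P_idem : forall X, P (P X) = P X.
Hypothesis P_abelian : forall X Y, P X = X -> P Y = Y -> br X Y = 0.
Hypothesis P_br : forall b c X Y, hom b X -> hom c Y ->
  P (br X Y) = P (br (P X) Y) + P (br X (P Y)).

(* An element [q[1] + a] of the shifted direct sum, together with its parity. *)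
Let T : Type := bool * (L * L).
Implicit Types (w y z : T) (x : seq T) (X Y : L) (b c : bool).

Definition par w := w.1.
Definition qpart w : L := w.2.1.
Definition apart w : L := w.2.2.

(** An entry of degree i has its first component in degree i + 1 of L', hence the negated parity. *)
Definition homog w :=
  [/\ hom (~~ par w) (qpart w), hom (par w) (apart w) & P (apart w) = apart w].

Definition homogs x := forall w, w \in x -> homog w.

Lemma brDl X X' Y : br (X + X') Y = br X Y + br X' Y.
Proof. by rewrite -[X]scale1r br_linl !scale1r. Qed.

Lemma br0l Y : br 0 Y = 0.
Proof. by have := br_linl (-1) 0 0 Y; rewrite scaler0 addr0 scaleN1r addNr. Qed.

Lemma brZl (k : K) X Y : br (k *: X) Y = k *: br X Y.
Proof. by have := br_linl k X 0 Y; rewrite br0l !addr0. Qed.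

Lemma brDr X Y Y' : br X (Y + Y') = br X Y + br X Y'.
Proof. by rewrite -[Y]scale1r br_linr !scale1r. Qed.

Lemma br0r X : br X 0 = 0.
Proof. by have := br_linr (-1) X 0 0; rewrite scaler0 addr0 scaleN1r addNr. Qed.

Lemma brZr (k : K) X Y : br X (k *: Y) = k *: br X Y.
Proof. by have := br_linr k X Y 0; rewrite br0r !addr0. Qed.

Lemma homZ b (k : K) X : hom b X -> hom b (k *: X).
Proof. by move=> hX; rewrite -[_ *: _]addr0; apply: hom_lin. Qed.

Lemma homD b X Y : hom b X -> hom b Y -> hom b (X + Y).
Proof. by move=> hX; rewrite -[X]scale1r; apply: hom_lin. Qed.

Lemma homogs_cons y x : homogs (y :: x) -> homog y /\ homogs x.
Proof.
move=> h; split; first by apply: h; rewrite mem_head.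
by move=> w wx; apply: h; rewrite inE wx orbT.
Qed.

Lemma homogs_perm A x : perm_eq A x -> homogs x -> homogs A.
Proof. by move=> Ax h w; rewrite (perm_mem Ax); exact: h. Qed.

Lemma homogs_cat A B x : perm_eq (A ++ B) x -> homogs x -> homogs A /\ homogs B.
Proof.
move=> ABx /(homogs_perm ABx) h.
by split=> w wx; apply: h; rewrite mem_cat wx ?orbT.
Qed.

Definition iter_br X x := foldl br X (map apart x).

Lemma iter_br_lin (k : K) X X' x :
  iter_br (k *: X + X') x = k *: iter_br X x + iter_br X' x.
Proof.
rewrite /iter_br; elim: x X X' => //= y x IH X X'.
by rewrite br_linl IH.
Qed.

Lemma iter_br0 x : iter_br 0 x = 0.
Proof. by rewrite /iter_br; elim: x => //= y x IH; rewrite br0l. Qed.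

Lemma iter_brZ (k : K) X x : iter_br (k *: X) x = k *: iter_br X x.
Proof. by have := iter_br_lin k X 0 x; rewrite iter_br0 !addr0. Qed.

Lemma iter_brD X X' x : iter_br (X + X') x = iter_br X x + iter_br X' x.
Proof. by rewrite -[X]scale1r iter_br_lin !scale1r. Qed.

Lemma iter_br_cons X y x : iter_br X (y :: x) = iter_br (br X (apart y)) x.
Proof. by []. Qed.

Lemma hom_iter_br b X x :
  homogs x -> hom b X -> hom (b (+) psum par x) (iter_br X x).
Proof.
elim: x b X => [|y x IH] b X hx hX; first by rewrite addbF.
have [[_ hy _] hx'] := homogs_cons hx.
by rewrite iter_br_cons psum_cons addbA; apply: IH => //; exact: hom_br.
Qed.

(** Each [-, a] is a derivation and distributes over the two factors; the sign moves [Y] past the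
    entries that go to [X]. *)
Lemma iter_br_br b c X Y x : homogs x -> hom b X -> hom c Y ->
  iter_br (br X Y) x = unsh par (fun A B =>
    (-1) ^+ (psum par A && c) *: br (iter_br X A) (iter_br Y B)) x.
Proof.
elim: x b c X Y => [|y x IH] b c X Y hx hX hY; first by rewrite /= scale1r.
have [[_ hy _] hx'] := homogs_cons hx.
rewrite iter_br_cons (br_jacobi hX hY hy) addrC iter_brD iter_brZ /=.
rewrite (IH _ _ _ _ hx' (hom_br hX hy) hY) (IH _ _ _ _ hx' hX (hom_br hY hy)).
rewrite -unshZ; congr (_ + _); apply: eq_unsh => A B _.
  by rewrite psum_cons iter_br_cons; signs K.
by rewrite iter_br_cons; signs K.
Qed.

(** In the Leibniz rule the term [X, [a, a']] vanishes, as the image of [P] is abelian. *)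
Lemma br_comm b c d X a a' : hom b X -> hom c a -> hom d a' ->
  P a = a -> P a' = a' -> br (br X a) a' = (-1) ^+ (c && d) *: br (br X a') a.
Proof.
by move=> hX ha ha' Pa Pa'; rewrite (br_jacobi hX ha ha') (P_abelian Pa Pa') br0r add0r.
Qed.

Lemma iter_br_swap b X u y z v : homogs (u ++ y :: z :: v) -> hom b X ->
  iter_br X (u ++ y :: z :: v) =
  (-1) ^+ (par y && par z) *: iter_br X (u ++ z :: y :: v).
Proof.
elim: u b X => [|t u IH] b X h hX /=.
  have [[_ hy Py] h'] := homogs_cons h; have [[_ hz Pz] _] := homogs_cons h'.
  by rewrite !iter_br_cons (br_comm hX hy hz Py Pz) iter_brZ.
have [[_ ht _] h'] := homogs_cons h.
by rewrite !iter_br_cons (IH _ _ h' (hom_br hX ht)).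
Qed.

Lemma br_iter_br b c X a x : homogs x -> hom b X -> hom c a -> P a = a ->
  br a (iter_br X x) = - ((-1) ^+ (b && c) *: iter_br (br X a) x).
Proof.
elim: x b X => [|y x IH] b X hx hX ha Pa.
  by rewrite /= (br_anti ha hX) andbC.
have [[_ hy Py] hx'] := homogs_cons hx.
rewrite !iter_br_cons (IH _ _ hx' (hom_br hX hy) ha Pa).
rewrite (br_comm hX hy ha Py Pa) iter_brZ; signs K.
Qed.

(** A distinguished entry [w] placed after [y] must pass [y] on its way to the front; [y] then acts
    by the first bracket. The weight [lam] is kept arbitrary so that this step stays within the
    recursion. *)
Definition wder (lam : T -> L) y w :=
  (-1) ^+ (par w && par y) *: br (lam w) (apart y).

(* [derived lam x] is the sum, over the entries [w] of [x], of the brackets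
   [[... [[lam w, a_1], a_2], ...], a_n] with the other entries, where [w] is
   first moved to the front, with the Koszul sign. *)
Fixpoint derived (lam : T -> L) x : L :=
  match x with
  | [::] => 0
  | y :: x => iter_br (lam y) x + derived (wder lam y) x
  end.

Definition wdeg c (lam : T -> L) x :=
  forall w, w \in x -> hom (par w (+) c) (lam w).

Lemma wdeg_cons c lam y x :
  wdeg c lam (y :: x) -> hom (par y (+) c) (lam y) /\ wdeg c lam x.
Proof.
move=> h; split; first by apply: h; rewrite mem_head.
by move=> w wx; apply: h; rewrite inE wx orbT.
Qed.

Lemma wdeg_wder c lam y x :
  homog y -> wdeg c lam x -> wdeg (c (+) par y) (wder lam y) x.
Proof.
by case=> _ hy _ h w wx; rewrite addbA; apply/homZ/hom_br => //; exact: h.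
Qed.

Lemma eq_derived lam lam' x :
  (forall w, w \in x -> lam w = lam' w) -> derived lam x = derived lam' x.
Proof.
elim: x lam lam' => //= y x IH lam lam' h; congr (_ + _).
  by rewrite h ?mem_head.
by apply: IH => w wx; rewrite /wder h // inE wx orbT.
Qed.

Lemma derived_lin (k : K) lam lam' x :
  derived (fun w => k *: lam w + lam' w) x = k *: derived lam x + derived lam' x.
Proof.
elim: x lam lam' => [|y x IH] lam lam' /=; first by rewrite scaler0 addr0.
rewrite iter_br_lin (@eq_derived _ (fun w => k *: wder lam y w + wder lam' y w)).
  by rewrite IH; lincomb K.
by move=> w _; rewrite /wder br_linl; lincomb K.
Qed.

Lemma derivedZ (k : K) lam x : derived (fun w => k *: lam w) x = k *: derived lam x.
Proof.
elim: x lam => [|y x IH] lam /=; first by rewrite scaler0.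
rewrite iter_brZ scalerDr -IH; congr (_ + _); apply: eq_derived => w _.
by rewrite /wder brZl !scalerA mulrC.
Qed.

Lemma hom_derived c lam x :
  homogs x -> wdeg c lam x -> hom (psum par x (+) c) (derived lam x).
Proof.
elim: x c lam => [|y x IH] c lam hx hl; first exact: hom0.
have [hy hx'] := homogs_cons hx; have [hly hl'] := wdeg_cons hl.
rewrite psum_cons /=; apply: homD.
  by rewrite -addbA (addbC (psum _ _)) addbA; exact: hom_iter_br.
rewrite (addbC (par y)) -addbA (addbC (par y)); apply: IH => //.
exact: wdeg_wder.
Qed.

Lemma derived_swap c lam u y z v : homogs (u ++ y :: z :: v) ->
  wdeg c lam (u ++ y :: z :: v) ->
  derived lam (u ++ y :: z :: v) =
  (-1) ^+ (par y && par z) *: derived lam (u ++ z :: y :: v).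
Proof.
elim: u c lam => [|t u IH] c lam h hl /=.
  have [[qy hy Py] h'] := homogs_cons h; have [[qz hz Pz] _] := homogs_cons h'.
  rewrite !iter_br_cons /wder !iter_brZ scalerDr scalerDr.
  rewrite -derivedZ addrCA; congr (_ + (_ + _)).
  - by signs K.
  - by signs K.
  apply: eq_derived => w wv; rewrite !brZl.
  have hw : hom (par w (+) c) (lam w) by apply: hl; rewrite !inE wv !orbT.
  by rewrite (br_comm hw hy hz Py Pz); signs K.
have [ht h'] := homogs_cons h; have [hlt hl'] := wdeg_cons hl.
by rewrite (iter_br_swap h' hlt) (IH _ _ h' (wdeg_wder ht hl')) scalerDr.
Qed.

Lemma br_derived c d lam a x : homogs x -> wdeg c lam x -> hom d a -> P a = a ->
  br a (derived lam x) = - ((-1) ^+ (c && d) *: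
    derived (fun w => (-1) ^+ (par w && d) *: br (lam w) a) x).
Proof.
elim: x c lam => [|y x IH] c lam hx hl ha Pa; first by rewrite /= br0r scaler0 oppr0.
have [hy hx'] := homogs_cons hx; have [hly hl'] := wdeg_cons hl.
have [_ hya Py] := hy.
rewrite /= brDr (br_iter_br hx' hly ha Pa) (IH _ _ hx' (wdeg_wder hy hl') ha Pa).
rewrite iter_brZ.
rewrite (@eq_derived (fun w => (-1) ^+ (par w && d) *: br (wder lam y w) a)
  (fun w => (-1) ^+ (par y && d) *:
     wder (fun w => (-1) ^+ (par w && d) *: br (lam w) a) y w)).
  by rewrite derivedZ; signs K.
move=> w wx; rewrite /wder !brZl (br_comm (hl' w wx) hya ha Py Pa).
by signs K.
Qed.

(** Here the start of the left factor is fixed; the unshuffles reassemble the Leibniz expansions of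
    the brackets of [X, lam w] with the other entries. *)
Lemma unsh_iter_derived b c lam X x : homogs x -> hom b X -> wdeg c lam x ->
  unsh par (fun A B => (-1) ^+ (psum par A && c) *:
    br (iter_br X A) (derived lam B)) x = derived (fun w => br X (lam w)) x.
Proof.
elim: x b c lam X => [|y x IH] b c lam X hx hX hl; first by rewrite /= br0r scaler0.
have [hy hx'] := homogs_cons hx; have [hly hl'] := wdeg_cons hl.
have [_ hya _] := hy; rewrite /=.
rewrite (@eq_derived (wder (fun w => br X (lam w)) y) (fun w =>
    (-1) ^+ (c && par y) *: br (br X (apart y)) (lam w) + br X (wder lam y w))); last first.
  move=> w wx; rewrite /wder (br_jacobi hX (hl' w wx) hya) brZr; signs K.
rewrite derived_lin -(IH _ _ _ _ hx' (hom_br hX hya) hl').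
rewrite -(IH _ _ _ _ hx' hX (wdeg_wder hy hl')) (iter_br_br hx' hX hly).
rewrite addrCA; congr (_ + _).
  rewrite -unshZ; apply: eq_unsh => A B _.
  by rewrite psum_cons iter_br_cons; signs K.
by rewrite -unshD; apply: eq_unsh => A B _; rewrite /= brDr; signs K.
Qed.

Lemma unsh_derived_iter b c kap Y x : homogs x -> wdeg b kap x -> hom c Y ->
  unsh par (fun A B => (-1) ^+ (psum par A && c) *:
    br (derived kap A) (iter_br Y B)) x =
  derived (fun w => (-1) ^+ (par w && c) *: br (kap w) Y) x.
Proof.
elim: x b c kap Y => [|y x IH] b c kap Y hx hk hY; first by rewrite /= br0l scaler0.
have [hy hx'] := homogs_cons hx; have [hky hk'] := wdeg_cons hk.
have [_ hya _] := hy; rewrite /=.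
rewrite (@eq_derived
  (wder (fun w => (-1) ^+ (par w && c) *: br (kap w) Y) y) (fun w =>
    (-1) ^+ (c && par y) *: ((-1) ^+ (par w && c) *: br (wder kap y w) Y)
    + (-1) ^+ (par w && (c (+) par y)) *: br (kap w) (br Y (apart y)))); last first.
  move=> w wx; rewrite /wder !brZl (br_jacobi (hk' w wx) hY hya); signs K.
rewrite derived_lin -(IH _ _ _ _ hx' (wdeg_wder hy hk') hY).
rewrite -(IH _ _ _ _ hx' hk' (hom_br hY hya)) iter_brZ (iter_br_br hx' hky hY).
rewrite addrA; congr (_ + _); last first.
  by apply: eq_unsh => A B _; rewrite iter_br_cons; signs K.
by rewrite -!unshZ -unshD; apply: eq_unsh => A B _; rewrite psum_cons /= brDl; signs K.
Qed.

Definition wder2 (bt : T -> T -> L) y w w' :=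
  (-1) ^+ ((par w (+) par w') && par y) *: br (bt w w') (apart y).

(** The analogue of [derived] with two distinguished entries, moved to the front in their order in
    the list. *)
Fixpoint derived2 (bt : T -> T -> L) x : L :=
  match x with
  | [::] => 0
  | y :: x => derived (bt y) x + derived2 (wder2 bt y) x
  end.

Lemma eq_derived2 bt bt' x :
  (forall w w', w \in x -> w' \in x -> bt w w' = bt' w w') ->
  derived2 bt x = derived2 bt' x.
Proof.
elim: x bt bt' => //= y x IH bt bt' h; congr (_ + _).
  by apply: eq_derived => w wx; rewrite h // inE ?eqxx // wx orbT.
by apply: IH => w w' wx wx'; rewrite /wder2 h // inE ?wx ?wx' orbT.
Qed.

Lemma derived2_lin k bt bt' x :
  derived2 (fun w w' => k *: bt w w' + bt' w w') x =
  k *: derived2 bt x + derived2 bt' x.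
Proof.
elim: x bt bt' => [|y x IH] bt bt' /=; first by rewrite scaler0 addr0.
rewrite derived_lin
  (@eq_derived2 _ (fun w w' => k *: wder2 bt y w w' + wder2 bt' y w w')).
  by rewrite IH; lincomb K.
by move=> w w' _ _; rewrite /wder2 br_linl; lincomb K.
Qed.

Lemma derived20 x : derived2 (fun _ _ => 0) x = 0.
Proof.
by have := derived2_lin (-1) (fun _ _ => 0) (fun _ _ => 0) x;
  rewrite scaler0 addr0 scaleN1r addNr.
Qed.

Lemma derived2Z k bt x : derived2 (fun w w' => k *: bt w w') x = k *: derived2 bt x.
Proof.
rewrite -[RHS]addr0 -[X in _ = _ + X](derived20 x) -derived2_lin.
by apply: eq_derived2 => w w' _ _; rewrite addr0.
Qed.

(** The two summands correspond to the order of the distinguished entries: the start of the left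
    factor comes before or after that of the right one. In the induction the first entry is either
    one of these starts or a further bracket on one side, and the latter terms combine by the
    Leibniz rule. *)
Lemma unsh_derived_derived b c kap lam x :
  homogs x -> wdeg b kap x -> wdeg c lam x ->
  unsh par (fun A B => (-1) ^+ (psum par A && c) *:
    br (derived kap A) (derived lam B)) x =
  derived2 (fun w w' => (-1) ^+ (par w && c) *: br (kap w) (lam w') +
    (-1) ^+ ((par w && par w') (+) (par w' && c)) *: br (kap w') (lam w)) x.
Proof.
elim: x b c kap lam => [|y x IH] b c kap lam hx hk hl; first by rewrite /= br0l scaler0.
have [hy hx'] := homogs_cons hx; have [hky hk'] := wdeg_cons hk.
have [hly hl'] := wdeg_cons hl; have [_ hya _] := hy; rewrite /=.
set bt := (X in _ = _ + derived2 X x).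
rewrite (@eq_derived2 bt (fun w w' => (-1) ^+ (c && par y) *:
   ((-1) ^+ (par w && c) *: br (wder kap y w) (lam w') +
    (-1) ^+ ((par w && par w') (+) (par w' && c)) *: br (wder kap y w') (lam w)) +
   ((-1) ^+ (par w && (c (+) par y)) *: br (kap w) (wder lam y w') +
    (-1) ^+ ((par w && par w') (+) (par w' && (c (+) par y))) *:
       br (kap w') (wder lam y w)))); last first.
  move=> w w' wx wx'; rewrite /bt /wder2 /wder !brDl !brZl !brZr.
  rewrite (br_jacobi (hk' w wx) (hl' w' wx') hya).
  rewrite (br_jacobi (hk' w' wx') (hl' w wx) hya).
  by signs K.
rewrite derived2_lin -(IH _ _ _ _ hx' (wdeg_wder hy hk') hl').
rewrite -(IH _ _ _ _ hx' hk' (wdeg_wder hy hl')).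
rewrite (@eq_derived _ (fun w => (-1) ^+ (par y && c) *: br (kap y) (lam w) +
   (-1) ^+ (par w && (par y (+) c)) *: br (kap w) (lam y))); last first.
  by move=> w _; signs K.
rewrite derived_lin -(unsh_iter_derived hx' hky hl').
rewrite -(unsh_derived_iter hx' hk' hly) addrACA.
congr (_ + _); rewrite -?unshZ -unshD; apply: eq_unsh => A B _.
  by rewrite psum_cons /= brDl; signs K.
by rewrite /= brDr; signs K.
Qed.

Lemma unsh_head0 X x :
  unsh par (fun A B => if A is [::] then iter_br X B else 0) x = iter_br X x.
Proof.
elim: x X => [|y x IH] X //=; rewrite unsh0 add0r iter_br_cons -IH.
by apply: eq_unsh => -[|z A] B _; rewrite ?andbF ?scale1r ?scaler0.
Qed.

Lemma unsh_head1 lam x :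
  unsh par (fun A B => if A is [:: w] then iter_br (lam w) B else 0) x =
  derived lam x.
Proof.
elim: x lam => [|y x IH] lam //=; congr (_ + _); first exact: unsh_head0.
rewrite -IH; apply: eq_unsh => -[|w [|z A]] B _; rewrite ?scaler0 //.
by rewrite iter_br_cons /wder iter_brZ psum_cons /psum /= addbF andbC.
Qed.

(** Identifies [derived2] with the Jacobi terms whose inner operation has two arguments, as needed
    for the inner [lie_part]. *)
Lemma unsh_head2 bt x :
  unsh par (fun A B => if A is [:: w; w'] then iter_br (bt w w') B else 0) x =
  derived2 bt x.
Proof.
elim: x bt => [|y x IH] bt //=; congr (_ + _); first exact: unsh_head1.
rewrite -IH; apply: eq_unsh => -[|w [|w' [|z A]]] B _; rewrite ?scaler0 //.
by rewrite iter_br_cons /wder2 iter_brZ !psum_cons /psum /= addbF andbC.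
Qed.

(* The bracket of the two entries of [x] that lie in [L'[1]]; the sign is the
   one of [(-1)^|q|], as [q[1]] has parity [|q| + 1]. *)
Definition lie_part x : L :=
  if x is [:: w; w'] then - ((-1) ^+ par w *: br (qpart w) (qpart w')) else 0.

Definition higher x : T := (~~ psum par x, (lie_part x, P (derived qpart x))).

Lemma wdeg_qpart x : homogs x -> wdeg true qpart x.
Proof. by move=> hx w /hx[]; rewrite addbT. Qed.

Lemma higher_homog x : homogs x -> homog (higher x).
Proof.
move=> hx; split; rewrite /= /par /qpart /apart /=; last exact: P_idem.
  rewrite negbK; case: x hx => [|w [|w' [|z x]]] hx; try exact: hom0.
  have [[hw _ _] /homogs_cons[[hw' _ _] _]] := homogs_cons hx.
  rewrite /= -scaleNr; apply: homZ; rewrite !psum_cons addbF.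
  by have := hom_br hw hw'; rewrite addbN addNb negbK.
by rewrite -addbT; apply: hom_P; apply: hom_derived => //; exact: wdeg_qpart.
Qed.

Lemma lie_part_swap u y z v : homogs (u ++ y :: z :: v) ->
  lie_part (u ++ y :: z :: v) =
  (-1) ^+ (par y && par z) *: lie_part (u ++ z :: y :: v).
Proof.
case: u => [|t [|t' [|t'' u]]]; rewrite ?scaler0 //.
case: v => [|t v] h; rewrite ?scaler0 //.
have [[hy _ _] /homogs_cons[[hz _ _] _]] := homogs_cons h.
by rewrite /= (br_anti hy hz); signs K.
Qed.

Lemma higher_lie_jacobi x : homogs x ->
  unsh par (fun A B => lie_part (higher A :: B)) x = 0.
Proof.
move=> hx; case: (eqVneq (size x) 3) => [|x3]; last first.
  apply: unsh1 => A B AB; case: B AB => [|w [|w' B]] // AB.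
  case: A AB => [|u [|v [|z A]]] // AB;
    rewrite /lie_part /qpart /= ?br0l ?scaler0 ?oppr0 //.
  by move: x3; rewrite -(perm_size AB).
case: x hx => [|u [|v [|w [|t x]]]] // hx _.
have [[hu _ _] /homogs_cons[[hv _ _] /homogs_cons[[hw _ _] _]]] := homogs_cons hx.
rewrite /lie_part /= /higher /par /qpart /= !psum_cons /psum /=.
rewrite -/(par u) -/(par v) -/(par w) -/(qpart u) -/(qpart v) -/(qpart w).
rewrite ?br0l -!scaleNr !brZl (br_jacobi hu hv hw).
rewrite (br_anti hu (hom_br hv hw)).
by signs K.
Qed.

Lemma PN X : P (- X) = - P X.
Proof. exact: linearN. Qed.

Lemma PZ (k : K) X : P (k *: X) = k *: P X.
Proof. exact: linearZ. Qed.

Hypothesis two_neq0 : (2 : K) != 0.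

Lemma higher_derived_jacobi x : homogs x ->
  unsh par (fun A B => P (derived qpart (higher A :: B))) x = 0.
Proof.
move=> hx; pose Phi := derived qpart.
have homPhi A : homogs A -> hom (~~ psum par A) (Phi A).
  by move=> hA; rewrite -addbT; apply: hom_derived => //; exact: wdeg_qpart.
pose S := unsh par (fun A B => (-1) ^+ psum par A *: P (br (P (Phi A)) (Phi B))) x.
pose D := derived2 (fun w w' => (-1) ^+ par w *: br (qpart w) (qpart w')) x.
have S2 : 2 *: S = 2 *: P D.
  transitivity (P (unsh par (fun A B =>
      (-1) ^+ (psum par A && true) *: br (Phi A) (Phi B)) x)).
    (* Exchanging A and B turns one half of [P_br] into the other one. *)
    have -> : 2 *: S = S + unsh par (fun A B =>
        (-1) ^+ psum par A *: P (br (Phi A) (P (Phi B)))) x.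
      rewrite [X in _ = _ + X]unshC scaler_nat mulr2n; congr (_ + _).
      apply: eq_unsh => A B /homogs_cat/(_ hx)[hA hB].
      rewrite (br_anti (hom_P (homPhi _ hA)) (homPhi _ hB)) PN PZ.
      by signs K.
    rewrite unsh_linear -unshD; apply: eq_unsh => A B /homogs_cat/(_ hx)[hA hB].
    by rewrite PZ (P_br (homPhi _ hA) (homPhi _ hB)) andbT scalerDr.
  rewrite (unsh_derived_derived hx (wdeg_qpart hx) (wdeg_qpart hx)).
  rewrite -linearZ -derived2Z.
  (* After the shift the bracket of two q's is graded symmetric, so the two orders of the
     distinguished entries contribute equally; this is the factor 2. *)
  congr (P _); apply: eq_derived2 => w w' /hx[hw _ _] /hx[hw' _ _].
  by rewrite (br_anti hw' hw); signs K.
have {S2} SD : S = P D by apply: (scalerI two_neq0).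
(* The head [higher A] acts through its L' component, the inner l_2, which gives [- P D], and
   through its component in a, which gives [S]. *)
transitivity (- P D + S); last by rewrite SD addNr.
have -> : - P D = P (unsh par (fun A B => iter_br (lie_part A) B) x).
  rewrite -linearN -scaleN1r -derived2Z -unsh_head2; congr (P _).
  apply: eq_unsh => -[|w [|w' [|z A]]] B _; rewrite ?iter_br0 //=.
  by rewrite scaleN1r.
rewrite unsh_linear -unshD; apply: eq_unsh => A B /homogs_cat/(_ hx)[hA hB].
rewrite /= linearD; congr (_ + _).
have hPA := hom_P (homPhi _ hA).
rewrite (br_derived hB (wdeg_qpart hB) hPA (P_idem _)).
rewrite -[derived (wder _ _) _]/(derived (fun w =>
  (-1) ^+ (par w && ~~ psum par A) *: br (qpart w) (P (Phi A))) B).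
by rewrite PN PZ; signs K.
Qed.

Lemma higher_gsym : gsym par homog (fun x => (higher x).2).
Proof.
move=> u y z v h; congr pair; first exact: lie_part_swap.
by rewrite (derived_swap h (wdeg_qpart h)) PZ.
Qed.

Lemma higher_jacobi x : homogs x ->
  unsh par (fun A B => (higher (higher A :: B)).2) x = 0.
Proof.
by move=> hx; rewrite unsh_pair higher_lie_jacobi // higher_derived_jacobi.
Qed.

(** [unsh] includes the splitting with [A] empty, whereas the generalized Jacobi identity starts
    with inner operations of one argument. *)
Lemma higher_nil B : (higher (higher [::] :: B)).2 = 0.
Proof.
have d0 : derived (fun=> 0) B = 0.
  by have := derivedZ 0 (fun=> 0) B; rewrite !scale0r.
rewrite /higher /= (@eq_derived _ (fun=> 0)) => [|w _]; last first.
  by rewrite /wder /apart /= linear0 br0r scaler0.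
rewrite d0 iter_br0 addr0 linear0; congr pair.
by case: (B) => [|w [|w' B']] //=; rewrite br0l scaler0 oppr0.
Qed.

(** The only sign left depends on [y] alone, so it can be replaced by a twist of its component in a,
    with no reference to the other degrees. *)
Lemma derived_cons x y : homogs (y :: x) ->
  derived qpart (y :: x) =
  iter_br (qpart y) x - br ((-1) ^+ par y *: apart y) (derived qpart x).
Proof.
move=> h; have [[_ hy Py] hx] := homogs_cons h.
rewrite brZl (br_derived hx (wdeg_qpart hx) hy Py) /= -/(wder qpart y).
rewrite -[derived (wder _ _) _]/(derived (fun w =>
  (-1) ^+ (par w && par y) *: br (qpart w) (apart y)) x).
by signs K.
Qed.
End HigherDerivedBrackets.

(** * Bidegrees *)

Section Weights.
Variables (K : fieldType) (g V : lmodType K).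
Local Notation E := (g * V)%type.
Local Notation L := (cochain E).
Local Notation inj := (map (@sum_inj K g V)).
Implicit Types (X Y : L) (i j k l : int).

Lemma cdeg_cpar i X : cdeg i X -> cpar (odd `|i|%N) X.
Proof.
move=> dX x xi; apply: dX => e; move: xi; case: i e => [n|[|n]] //.
  by rewrite -PoszD => -[->]; rewrite addn1 absz_nat /=; case: odd.
by case=> ->.
Qed.

Lemma cdeg_lt0 i X : i < 0 -> cdeg i X -> X = 0.
Proof.
move=> i0 dX; apply: cochain_eq => -[|y x]; first by have [-> _ _] := subP X.
by apply: dX; case: i i0 => [n|[|n]].
Qed.

Lemma cdeg_bracket i j X Y : cdeg i X -> cdeg j Y -> cdeg (i + j) (bracket X Y).
Proof.
move=> dX dY; have br0 Z : bracket 0 Z = 0 :> L.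
  exact: (br0l (@bracket_linl K E)).
have brr0 Z : bracket Z 0 = 0 :> L.
  exact: (br0r (@bracket_linr K E)).
case: i dX => [m|m] dX; last by rewrite (cdeg_lt0 _ dX) // br0.
case: j dY => [n|n] dY; last by rewrite (cdeg_lt0 _ dY) // brr0.
by have [h _] := bracket_homogeneous dX dY.
Qed.

(* [e] lies in the summand of the weight [c], where [g] and [V] have the
   weights 0 and 1. *)
Definition in_weight (c : int) (e : E) :=
  [/\ c = 0 -> e.2 = 0, c = 1 -> e.1 = 0 & c <> 0 -> c <> 1 -> e = 0].

(** One additive weight per entry replaces the two counts of [in_gV]: a map of bidegree k|l lowers
    the total weight by l. Weights other than 0 and 1 are allowed and force the vector 0, so
    inserted values need no case distinction. *)
Definition weighted l (f : seq E -> E) := forall t : seq (int * E),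
  (forall p, p \in t -> in_weight p.1 p.2) ->
  in_weight (\sum_(p <- t) p.1 - l) (f (map snd t)).

Lemma in_weight_lin c a e e' :
  in_weight c e -> in_weight c e' -> in_weight c (a *: e + e').
Proof.
move=> [h1 h2 h3] [h1' h2' h3']; split=> [c0|c1|c0 c1].
- by rewrite /= h1 // h1' // scaler0 addr0.
- by rewrite /= h2 // h2' // scaler0 addr0.
- by rewrite h3 // h3' // scaler0 addr0.
Qed.

Lemma in_weight0 c : in_weight c 0.
Proof. by []. Qed.

Lemma in_weightZ c a e : in_weight c e -> in_weight c (a *: e).
Proof. by move=> h; rewrite -[_ *: _]addr0; apply: in_weight_lin. Qed.

Lemma in_weightD c e e' : in_weight c e -> in_weight c e' -> in_weight c (e + e').
Proof. by move=> h; rewrite -[e]scale1r; apply: in_weight_lin. Qed.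

Lemma weighted_lin l a f f' :
  weighted l f -> weighted l f' -> weighted l (a *: f + f').
Proof. by move=> h h' t ht; apply: in_weight_lin; [exact: h | exact: h']. Qed.

Lemma weighted_deriv l f c e :
  weighted l f -> in_weight c e -> weighted (l - c) (deriv f e).
Proof.
move=> h hc t ht; have := h ((c, e) :: t).
rewrite big_cons /= opprB addrA [_ + c]addrC; apply=> p.
by rewrite inE => /orP[/eqP->|/ht].
Qed.

Lemma weighted_twist l f : weighted l f -> weighted l (twist f).
Proof. by move=> h t ht; apply/in_weightZ/h. Qed.

Lemma weighted_ins l l' f f' :
  weighted l f -> weighted l' f' -> weighted (l + l') (ins f f').
Proof.
move=> h h' t; elim: t l l' f f' h h' => [|[c e] t IH] l l' f f' h h' ht.
  exact: in_weight0.
have hc : in_weight c e by apply: (ht (c, e)); rewrite mem_head.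
have ht' p : p \in t -> in_weight p.1 p.2.
  by move=> pt; apply: ht; rewrite inE pt orbT.
rewrite /= big_cons /=; apply: in_weightD; first apply: in_weightD.
- have := h ((c - l', f' [:: e]) :: t).
  rewrite big_cons /= opprD addrA addrAC [_ - l' + _]addrAC [X in in_weight X]addrAC; apply=> p.
  rewrite inE => /orP[/eqP->|/ht'//] /=.
  have := h' [:: (c, e)]; rewrite big_seq1; apply=> p'.
  by rewrite inE => /eqP->.
- have := IH _ _ _ _ (weighted_deriv h hc) (weighted_twist h') ht'.
  by rewrite addrAC opprB addrA [_ + c]addrC.
- have := IH _ _ _ _ h (weighted_deriv h' hc) ht'.
  by rewrite addrA opprB addrA [_ + c]addrC.
Qed.

Lemma weighted_bracket_par b c l l' X Y : cpar b X -> cpar c Y ->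
  weighted l (\val X) -> weighted l' (\val Y) ->
  weighted (l + l') (\val (bracket X Y)).
Proof.
move=> pX pY hX hY t ht; rewrite (bracketE _ pX pY) [X in in_weight _ X]addrC -scaleNr.
apply: in_weight_lin; last exact: weighted_ins.
by rewrite [l + l']addrC; apply: weighted_ins.
Qed.

(** An entry of weight other than 0 and 1 is zero and makes the value vanish by multilinearity; the
    remaining sequences are images of pure ones. *)
Lemma weighted_pure l X :
  (forall t,
     in_weight ((count (fun y => ~~ is_inl y) t)%:Z - l) (\val X (inj t))) ->
  weighted l (\val X).
Proof.
move=> h t ht; case: (pselect (exists2 p, p \in t & p.2 = 0)) => [[p pt p0]|nz].
  case/splitPr: pt => t1 t2; rewrite map_cat /= p0 multilinear0 //.
  exact: cochain_mul.
pose c (p : int * E) : g + V := if p.1 == 0 then inl p.2.1 else inr p.2.2.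
have hc p : p \in t -> p.1 = (~~ is_inl (c p))%:Z /\ p.2 = sum_inj (c p).
  move=> pt; have [h0 h1 h2] := ht p pt; rewrite /c.
  have [e|e] := eqVneq p.1 0.
    by split; rewrite // [LHS]surjective_pairing h0.
  have [e1|e1] := eqVneq p.1 1.
    by split; rewrite // [LHS]surjective_pairing h1.
  by case: nz; exists p => //; apply: h2; apply/eqP.
have -> : map snd t = inj (map c t).
  by rewrite -map_comp; apply/eq_in_map => p /hc[].
have -> : \sum_(p <- t) p.1 =
    (count (fun y => ~~ is_inl y) (map c t))%:Z; last exact: h.
elim: t {ht nz} hc => [|p t IH] hc; first by rewrite big_nil.
rewrite big_cons /= PoszD -IH; last by move=> q qt; apply: hc; rewrite inE qt orbT.
by have [-> _] := hc p (mem_head _ _).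
Qed.

Lemma count_inl_inr (t : seq (g + V)) :
  (size t)%:Z = (count (fun y => is_inl y) t)%:Z
                + (count (fun y => ~~ is_inl y) t)%:Z.
Proof. by rewrite -PoszD (count_predC (fun y => is_inl y)). Qed.

(** Once the arity is fixed, the number of entries in V determines the number in g, so the weight
    condition carries all the remaining information. *)
Lemma bidegP k l X :
  bideg k l X <-> cdeg (k + l) X /\ weighted l (\val X).
Proof.
split=> [[dX h2 h1 h0]|[dX hX]].
  split=> //; apply: weighted_pure => t.
  have [e|ne] := eqVneq (size (inj t))%:Z (k + l + 1); last first.
    by rewrite dX; [|apply/eqP].
  rewrite size_map count_inl_inr in e.
  by split=> [c0|c1|c0 c1]; [apply: h2|apply: h1|apply: h0 => -[]];
    rewrite /in_gV; lia.
have wt (t : seq (g + V)) :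
    in_weight ((count (fun y => ~~ is_inl y) t)%:Z - l) (\val X (inj t)).
  have h p : p \in [seq ((~~ is_inl y)%:Z, sum_inj y) | y <- t] ->
      in_weight p.1 p.2 by case/mapP=> -[y|y] _ ->.
  have := hX _ h; rewrite big_map -map_comp; congr (in_weight (_ - _) _).
  by elim: (t) => [|y s IH]; rewrite ?big_nil // big_cons IH PoszD.
split=> // [t [_ cV]|t [_ cV]|t n1 n2].
- by have [h _ _] := wt t; apply: h; rewrite cV subrr.
- by have [_ h _] := wt t; apply: h; rewrite cV addrC addKr.
have [e|ne] := eqVneq (size (inj t))%:Z (k + l + 1); last first.
  by apply: dX; apply/eqP.
rewrite size_map count_inl_inr in e.
have [_ _ h] := wt t; apply: h => c0; [apply: n1 | apply: n2];
  rewrite /in_gV; lia.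
Qed.

Lemma bideg_bracket k l k' l' X Y : bideg k l X -> bideg k' l' Y ->
  bideg (k + k') (l + l') (bracket X Y).
Proof.
move=> /bidegP[dX wX] /bidegP[dY wY]; apply/bidegP; split.
  by rewrite addrACA; exact: cdeg_bracket.
exact: weighted_bracket_par (cdeg_cpar dX) (cdeg_cpar dY) wX wY.
Qed.
End Weights.

(** * The projection onto the abelian subalgebra *)

Section Projection.
Variables (K : fieldType) (g V : lmodType K).
Local Notation E := (g * V)%type.
Local Notation L := (cochain E).
Local Notation inj := (map (@sum_inj K g V)).
Local Notation proj := (@proj K g V).
Implicit Types (X Y : L) (i j k l : int).

Lemma cpar_lin b a X Y : cpar b X -> cpar b Y -> cpar b (a *: X + Y).
Proof.
move=> pX pY x hx; change (a *: \val X x + \val Y x = 0).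
by rewrite pX // pY // scaler0 addr0.
Qed.

Lemma cpar_proj b X : cpar b X -> cpar b (proj X).
Proof. by move=> pX x hx; rewrite /= /proj_fun pX // size_map. Qed.

Lemma proj_idem X : proj (proj X) = proj X.
Proof. by apply: cochain_eq => x; rewrite /= /proj_fun /= -map_comp. Qed.

(** The inner cochain takes values in g, while the outer one sees only the V-components of its
    arguments. *)
Lemma diamond_proj m n (f h : seq E -> E) x : multilinear f ->
  diamond m n (proj_fun f) (proj_fun h) x = 0.
Proof.
move=> fM; rewrite /diamond big1 // => j _; rewrite big1 ?scaler0 // => s _.
by rewrite {1}/proj_fun map_cat /= /to_V /= (multilinear0 _ _ fM) scaler0.
Qed.

Lemma proj_abelian X Y : proj X = X -> proj Y = Y -> bracket X Y = 0.
Proof.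
move=> <- <-; apply: cochain_eq => x.
rewrite /= /bracket_fun big1 // => m _ /=.
by rewrite !diamond_proj ?scaler0 ?subr0 //; exact: cochain_mul.
Qed.

Definition preserves_V (f : seq E -> E) :=
  forall x, (f (map (@to_V K g V) x)).1 = 0.

Lemma ins_preserves_V f h :
  preserves_V f -> preserves_V h -> preserves_V (ins f h).
Proof.
move=> hf hh x; elim: x f h hf hh => //= y x IH f h hf hh.
have toVE (e : E) : e.1 = 0 -> e = to_V e.
  by case: e => e1 e2 /= ->.
rewrite (IH (deriv f _)) ?(IH f) //=; first last.
- by move=> z; rewrite /twist /= hh scaler0.
- by move=> z; exact: (hf (y :: z)).
- by move=> z; exact: (hh (y :: z)).
rewrite !addr0 (toVE (h _)); last exact: (hh [:: y]).
exact: (hf (_ :: x)).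
Qed.

Lemma proj0_preserves_V X : proj X = 0 <-> preserves_V (\val X).
Proof.
split=> [h x|h]; first by have /(congr1 (fun f => (f x).1)) := congr1 val h.
by apply: cochain_eq => x; rewrite /= /proj_fun h.
Qed.

(* The kernel of [proj] is a subalgebra and its image is abelian. *)
Lemma proj_bracket b c X Y : cpar b X -> cpar c Y ->
  proj (bracket X Y) = proj (bracket (proj X) Y) + proj (bracket X (proj Y)).
Proof.
move=> pX pY.
have sub_par d Z : cpar d Z -> cpar d (Z - proj Z).
  by move=> pZ; rewrite -scaleN1r addrC; apply: cpar_lin => //; exact: cpar_proj.
have sub_proj Z : proj (Z - proj Z) = 0 by rewrite linearB /= proj_idem subrr.
have : proj (bracket (X - proj X) (Y - proj Y)) = 0.
  apply/proj0_preserves_V => x; rewrite (bracketE _ (sub_par _ _ pX) (sub_par _ _ pY)) /=.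
  have VX := (proj0_preserves_V _).1 (sub_proj X).
  have VY := (proj0_preserves_V _).1 (sub_proj Y).
  by rewrite !ins_preserves_V // scaler0 subr0.
have -> : bracket (X - proj X) (Y - proj Y) =
    bracket X Y - (bracket (proj X) Y + bracket X (proj Y)).
  rewrite -!scaleN1r [X + _]addrC [Y + _]addrC bracket_linl !bracket_linr.
  rewrite (proj_abelian (proj_idem X) (proj_idem Y)).
  by lincomb K.
by rewrite linearB linearD => /eqP; rewrite subr_eq0 => /eqP.
Qed.

Lemma ctwist_cochain X : cochain_space E (twist (\val X)).
Proof.
have [X0 XM [N XN]] := subP X; split; last first.
- by exists N => x xN; rewrite /twist XN ?scaler0.
- exact: twist_multilinear.
- by rewrite /twist X0 scaler0.
Qed.

Definition ctwist X : L := mk_sub (ctwist_cochain X).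

Lemma ctwist_lin a X Y : ctwist (a *: X + Y) = a *: ctwist X + ctwist Y.
Proof.
apply: cochain_eq => x.
change (twist (a *: \val X + \val Y) x = a *: twist (\val X) x + twist (\val Y) x).
rewrite /twist scalerDr !scalerA.
by rewrite [a * _]mulrC -scalerA.
Qed.

Lemma ctwistE b X : cpar b X -> ctwist X = (-1) ^+ b *: X.
Proof. by move=> pX; apply: cochain_eq => x; rewrite /= (twistE pX). Qed.

Lemma ctwist0 : ctwist 0 = 0.
Proof. by apply: cochain_eq => x; rewrite /= /twist scaler0. Qed.

Lemma val_sum n (c : nat -> L) x :
  \val (\sum_(i < n) c i) x = \sum_(i < n) \val (c i) x.
Proof.
elim: n => [|n IH]; first by rewrite !big_ord0.
by rewrite !big_ord_recr -IH.
Qed.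

Lemma sum_trunc X :
  exists N, forall M, (N <= M)%N -> X = \sum_(n < M) trunc n X.
Proof.
have [X0 _ [N XN]] := subP X; exists N => M NM; apply: cochain_eq => x.
rewrite (val_sum M (fun n => trunc n X)).
case: x => [|y x]; first by rewrite X0 big1.
case: (ltnP (size x) M) => h.
  rewrite (bigD1 (Ordinal h)) //= {1}/trunc_fun eqxx big1 ?addr0 // => i ni.
  rewrite /trunc_fun /= eqSS; case: eqP => // si; case/eqP: ni.
  exact: val_inj.
rewrite XN ?(leq_ltn_trans NM) // big1 // => i _; rewrite /= /trunc_fun /= eqSS.
by case: eqP => // si; have := ltn_ord i; rewrite -si ltnNge h.
Qed.

Lemma cdeg_trunc n X : cdeg n%:Z (trunc n X).
Proof.
move=> x hx; rewrite /= /trunc_fun; case: eqP => // e.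
by case: hx; rewrite e intS addrC.
Qed.

Lemma weighted_trunc l n X : weighted l (\val X) -> weighted l (\val (trunc n X)).
Proof.
move=> h t ht; rewrite /= /trunc_fun.
by case: ifP => _; [exact: h | exact: in_weight0].
Qed.

Lemma weighted_sum l n (c : nat -> L) :
  (forall m : nat, weighted l (\val (c m))) -> weighted l (\val (\sum_(i < n) c i)).
Proof.
elim: n => [|n IH] h; first by rewrite big_ord0 => t _; exact: in_weight0.
rewrite big_ord_recr /= addrC -[c n]scale1r.
by apply: (@weighted_lin _ _ _ _ _ (\val (c n))); [exact: h | exact: IH].
Qed.

(** The index k of C^{k|0} is determined by the arity, so membership in L' is a condition on weights
    alone; truncations to one arity give the summands. *)
Lemma LprimeP X : Lprime_space g V X <-> weighted 0 (\val X).
Proof.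
split=> [[N [c [hc ->]]]|h].
  by apply: weighted_sum => i; have /bidegP[] := hc i.
have [N /(_ N (leqnn N)) XE] := sum_trunc X.
exists N, (fun n => trunc n X); split=> // n.
by apply/bidegP; split; [rewrite addr0; exact: cdeg_trunc | exact: weighted_trunc].
Qed.

Lemma Lprime_bracket X Y :
  Lprime_space g V X -> Lprime_space g V Y -> Lprime_space g V (bracket X Y).
Proof.
move=> /LprimeP hX /LprimeP hY; apply/LprimeP.
(* Elements of L' may mix parities, but the weight of a bracket is known only for factors of a given
   parity; hence the decomposition into arities. *)
have [N /(_ N (leqnn N)) XE] := sum_trunc X.
have [M /(_ M (leqnn M)) YE] := sum_trunc Y.
have bracket_sum n (c : nat -> L) Z :
    bracket (\sum_(i < n) c i) Z = \sum_(i < n) bracket (c i) Z.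
  elim: n => [|n IH]; first by rewrite !big_ord0; exact: (br0l (@bracket_linl K E)).
  rewrite !big_ord_recr /= -IH -[in LHS](scale1r (\sum_(i < n) c i)).
  by rewrite bracket_linl scale1r.
have bracket_sumr n (c : nat -> L) Z :
    bracket Z (\sum_(i < n) c i) = \sum_(i < n) bracket Z (c i).
  elim: n => [|n IH]; first by rewrite !big_ord0; exact: (br0r (@bracket_linr K E)).
  rewrite !big_ord_recr /= -IH -[in LHS](scale1r (\sum_(i < n) c i)).
  by rewrite bracket_linr scale1r.
rewrite XE (bracket_sum N (fun n => trunc n X) Y).
apply: (@weighted_sum _ _ (fun n => bracket (trunc n X) Y)) => n.
rewrite YE (bracket_sumr M (fun n => trunc n Y) _).
apply: (@weighted_sum _ _ (fun m => bracket (trunc n X) (trunc m Y))) => m.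
have := weighted_bracket_par
  (cdeg_cpar (@cdeg_trunc n X)) (cdeg_cpar (@cdeg_trunc m Y))
  (weighted_trunc n hX) (weighted_trunc m hY).
by rewrite addr0.
Qed.

Lemma Lprime_ctwist X : Lprime_space g V X -> Lprime_space g V (ctwist X).
Proof. by move=> /LprimeP h; apply/LprimeP; exact: weighted_twist. Qed.

Lemma bideg_lt k l X : k < -1 -> bideg k l X -> X = 0.
Proof.
move=> k1 [_ _ _ h]; have XM := cochain_mul X.
have X0 t : \val X (inj t) = 0 by apply: h => -[]; lia.
apply: cochain_eq => x; rewrite (to_V_only XM) => [|t _ //].
have -> : map (@to_V K g V) x = inj [seq inr y.2 | y <- x].
  by rewrite -map_comp; apply: eq_map.
exact: X0.
Qed.

Lemma cdeg_proj i X : cdeg i X -> cdeg i (proj X).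
Proof. by move=> dX x hx; rewrite /= /proj_fun dX ?size_map. Qed.

Lemma proj_deg i X : cdeg i X ->
  if 0 <= i then bideg (-1) (i + 1) (proj X) else proj X = 0.
Proof.
move=> dX; case: (boolP (0 <= i)) => i0; last first.
  have i1 : i < 0 by lia.
  by rewrite (cdeg_lt0 i1 dX) linear0.
have dP := cdeg_proj dX; split.
- by have -> : -1 + (i + 1) = i by lia.
- by [].
- by move=> t [ct _]; exfalso; lia.
move=> t nt _; have [ht|ht] := boolP (has (fun y => is_inl y) t).
  by rewrite /= /proj_fun to_V_killed //; exact: cochain_mul.
apply: dP; rewrite size_map count_inl_inr => e; apply: nt.
have c0 : count (fun y : g + V => is_inl y) t = 0%N.
  by apply/eqP; rewrite -leqn0 leqNgt -has_count.
by rewrite /in_gV c0; lia.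
Qed.

(** P is prescribed on a and on the bidegrees with k >= 0. For l >= 0 these cover everything, since
    nothing nonzero has k < -1 or bidegree -1|0. *)
Lemma projection_bideg (P : {linear L -> L}) k l X :
  is_projection_on_a P -> 0 <= l -> bideg k l X -> P X = proj X.
Proof.
move=> [_ PE P0] l0 hX; have [k1|k1] := boolP (k < -1).
  by rewrite (bideg_lt k1 hX) !linear0.
have [k0|k0] := boolP (0 <= k).
  by rewrite (P0 _ _ _ k0 _ _ hX) ?(proj_bideg k0 hX) //; lia.
have kE : k = -1 by lia.
rewrite kE {k k1 k0 kE} in hX.
have [lE|l1] := eqVneq l 0.
  case: hX; rewrite lE addr0 => dX _ _ _.
  by rewrite (cdeg_lt0 _ dX) // !linear0.
have {l1} [n lE] : exists n : nat, l = n%:Z + 1 by exists `|l - 1|%N; lia.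
rewrite lE in hX; rewrite (proj_bideg_a hX) PE //.
exact: (sum_of_incl (fun n : nat => bideg_subspace g V (-1) (n%:Z + 1)) hX).
Qed.
End Projection.

(** * The structure maps *)

Section HigherBracketsOnCochains.
Variables (K : fieldType) (g V : lmodType K).
Hypothesis charK : [pchar K] =i pred0.
Local Notation E := (g * V)%type.
Local Notation L := (cochain E).
Local Notation M := (Lprime g V * fra g V)%type.
Local Notation proj := (@proj K g V).
Local Notation homog := (homog (@cpar K E) proj).
Local Notation homogs := (homogs (@cpar K E) proj).
Local Notation higher := (higher (@bracket K E) proj).
Implicit Types (X Y : L) (i j k : int).

Lemma cpar0 b : cpar b (0 : L).
Proof. by []. Qed.

Lemma two_neq0 : (2 : K) != 0.
Proof. by apply/negP => h; have := charK 2%N; rewrite inE /= h. Qed.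

Definition lie_val (x : seq (L * L)) : L :=
  if x is [:: z; z'] then bracket (ctwist z.1) z'.1 else 0.

(* On homogeneous entries this is [derived] (see [derived_cons]), written
   without explicit degrees so that it is multilinear on all sequences. *)
Fixpoint derived_val (x : seq (L * L)) : L :=
  match x with
  | [::] => 0
  | z :: x => foldl (@bracket K E) z.1 (map snd x)
              - bracket (ctwist z.2) (derived_val x)
  end.

Definition structure_val x := (lie_val x, proj (derived_val x)).

Lemma lie_valP x : Lprime_space g V (lie_val (map (@to_L K g V) x)).
Proof.
have L0 : Lprime_space g V 0 by apply/LprimeP => t _; exact: in_weight0.
case: x => [|z [|z' [|z'' x]]] //=.
by apply: Lprime_bracket; [apply: Lprime_ctwist|]; exact: subP.
Qed.

Definition structure_map (x : seq M) : M :=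
  (mk_sub (lie_valP x), mk_sub (proj_in_a (derived_val (map (@to_L K g V) x)))).

Lemma to_L_structure x :
  to_L (structure_map x) = structure_val (map (@to_L K g V) x).
Proof. by []. Qed.

Lemma to_L_inj : injective (@to_L K g V).
Proof. by case=> [q a] [q' a'] [/val_inj-> /val_inj->]. Qed.

Lemma to_L_lin c (u v : M) : to_L (c *: u + v) = c *: to_L u + to_L v.
Proof. by []. Qed.

Lemma structure_val_higher x : homogs x -> structure_val (map snd x) = (higher x).2.
Proof.
move=> hx; congr (_, proj _).
  case: x hx => [|w [|w' [|w'' x]]] //= /homogs_cons[[hw _ _] _].
  by rewrite (ctwistE hw) (brZl (@bracket_linl K E)) -scaleNr; congr (_ *: _);
    case: (par w); rewrite ?opprK.
elim: x hx => //= y x IH h; have [[_ hy _] hx] := homogs_cons h.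
rewrite IH // -map_comp (ctwistE hy) -/(derived _ _ (y :: x)).
by rewrite (derived_cons (@bracket_linl K E) (@bracket_linr K E)
  (@cpar_lin K g V) cpar0 (@cpar_bracket K E) (@bracket_anti K E)
  (@bracket_jacobi K E) (@proj_abelian K g V) h).
Qed.

Lemma higher_cochain_homog x : homogs x -> homog (higher x).
Proof.
exact: (higher_homog (@cpar_lin K g V) cpar0 (@cpar_bracket K E)
  (@cpar_proj K g V) (@proj_idem K g V)).
Qed.

Lemma higher_cochain_gsym : gsym (@par K L) homog (fun x => (higher x).2).
Proof.
exact: (higher_gsym (@bracket_linl K E) (@bracket_linr K E)
  (@cpar_lin K g V) cpar0 (@cpar_bracket K E) (@bracket_anti K E)
  (@bracket_jacobi K E) (@proj_abelian K g V)).
Qed.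

Lemma higher_cochain_jacobi x : homogs x ->
  unsh (@par K L) (fun A B => (higher (higher A :: B)).2) x = 0.
Proof.
exact: (higher_jacobi (@bracket_linl K E) (@bracket_linr K E)
  (@cpar_lin K g V) cpar0 (@cpar_bracket K E) (@bracket_anti K E)
  (@bracket_jacobi K E) (@cpar_proj K g V)
  (@proj_idem K g V) (@proj_abelian K g V) (@proj_bracket K g V) two_neq0).
Qed.
End HigherBracketsOnCochains.

(** * Graded symmetry and the generalized Jacobi identity *)

Section StructureAxioms.
Variables (K : fieldType) (g V : lmodType K).
Hypothesis charK : [pchar K] =i pred0.
Local Notation E := (g * V)%type.
Local Notation L := (cochain E).
Local Notation M := (Lprime g V * fra g V)%type.
Local Notation proj := (@proj K g V).
Local Notation homog := (homog (@cpar K E) proj).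
Local Notation homogs := (homogs (@cpar K E) proj).
Local Notation gr := (@shifted_deg K g V).
Local Notation toL := (map (@to_L K g V)).
Implicit Types (X Y : L).

Lemma Lprime_deg_cdeg (i : int) (q : Lprime g V) : Lprime_deg i q -> cdeg i (\val q).
Proof.
rewrite /Lprime_deg; case: ifP => _ [h]; last by rewrite h.
by move: h; rewrite addr0.
Qed.

Lemma fra_deg_cdeg (i : int) (a : fra g V) :
  fra_deg i a -> cdeg i (\val a) /\ proj (\val a) = \val a.
Proof.
rewrite /fra_deg; case: ifP => [i0 h|_ ->]; last first.
  by split=> //; exact: linear0.
have -> : i = -1 + (i + 1) by lia.
split; first by case: h.
by case: i i0 h => // n _; exact: proj_bideg_a.
Qed.

(** Parities come from [d] and not from the entries, since 0 is homogeneous of every degree. *)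
Definition decorate (d : nat -> int) (x : seq M) : seq (bool * (L * L)) :=
  [seq (odd `|d i|%N, to_L x`_i) | i <- iota 0 (size x)].

Lemma decorate_snd d x : map snd (decorate d x) = toL x.
Proof.
rewrite /decorate -map_comp; apply: (@eq_from_nth _ 0).
  by rewrite !size_map size_iota.
move=> i; rewrite size_map size_iota => h.
by rewrite (nth_map 0%N) ?size_iota // nth_iota // (nth_map 0).
Qed.

Lemma size_decorate d x : size (decorate d x) = size x.
Proof. by rewrite size_map size_iota. Qed.

Lemma par_decorate d x i :
  (i < size x)%N -> odd `|d i|%N = par (decorate d x)`_i.
Proof. by move=> h; rewrite (nth_map 0%N) ?size_iota // nth_iota. Qed.

Lemma homog_decorate d x : homogeneous gr d x -> homogs (decorate d x).
Proof.
move=> hx w /mapP[i]; rewrite mem_iota => /andP[_ h] ->.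
have [hq ha] := hx i h; have [da pa] := fra_deg_cdeg ha.
split=> //; last exact: cdeg_cpar.
have -> : ~~ odd `|d i|%N = odd `|(d i + 1)%R|%N by lia.
exact: cdeg_cpar (Lprime_deg_cdeg hq).
Qed.

Lemma structure_mapP (x : seq M) dx : homogs dx -> map snd dx = toL x ->
  to_L (structure_map x) = (higher (@bracket K E) proj dx).2.
Proof. by move=> h e; rewrite to_L_structure -e structure_val_higher. Qed.

Lemma structure_sym d x (s : 'S_(size x)) : homogeneous gr d x ->
  structure_map (reorder s x) = koszul K d s *: structure_map x.
Proof.
move=> hx; have hd := homog_decorate hx.
have sd : size (decorate d x) = size x by exact: size_decorate.
apply: to_L_inj; rewrite -[_ *: _]addr0 to_L_lin addr0.
rewrite (structure_mapP hd (decorate_snd _ _)).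
rewrite (@structure_mapP _ (reorder s (decorate d x))).
- exact: (gsym_reorder s (@higher_cochain_gsym K g V) sd hd (@par_decorate d x)).
- by apply: homogs_perm hd; exact: perm_reorder.
by rewrite map_reorder // decorate_snd map_reorder.
Qed.

Lemma to_L_sum (I : Type) (r : seq I) (Q : pred I) (F : I -> M) :
  to_L (\sum_(i <- r | Q i) F i) = \sum_(i <- r | Q i) to_L (F i).
Proof.
elim: r => [|i r IH]; first by rewrite !big_nil.
rewrite !big_cons; case: ifP => // _.
by rewrite -IH -[F i]scale1r to_L_lin !scale1r.
Qed.

Lemma structure_jacobi d x : homogeneous gr d x ->
  \sum_(1 <= i < (size x).+1) \sum_(s in Sh i (size x - i))
    koszul K d s *:
      structure_map (structure_map (take i (reorder s x)) :: drop i (reorder s x)) = 0.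
Proof.
move=> hx; have hd := homog_decorate hx; set dx := decorate d x in hd.
have sd : size dx = size x by exact: size_decorate.
pose H A B := (higher (@bracket K E) proj (higher (@bracket K E) proj A :: B)).2.
apply: to_L_inj; rewrite to_L_sum [RHS]/=.
transitivity (\sum_(1 <= i < (size x).+1)
    unsh (@par K L) (fun A B => if size A == i then H A B else 0) dx).
  apply: eq_big_nat => i /andP[_ ix].
  have ei : (i + (size x - i))%N = size x by rewrite subnKC.
  rewrite -(@shuffle_sum _ _ _ _ (i + (size x - i)) i d); first last.
  - by move=> k hk; apply: par_decorate; rewrite -ei.
  - exact: leq_addr.
  - by rewrite sd ei.
  rewrite to_L_sum; apply: eq_bigr => s _.
  rewrite -[_ *: structure_map _]addr0 to_L_lin addr0; congr (_ *: _).
  set A := take i (reorder s dx); set B := drop i (reorder s dx).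
  have pAB : perm_eq (A ++ B) dx by rewrite cat_take_drop perm_reorder // sd ei.
  have [hA hB] := homogs_cat pAB hd.
  have rE : map snd (reorder s dx) = toL (reorder s x).
    by rewrite !map_reorder ?sd ?ei // decorate_snd.
  have AE : map snd A = toL (take i (reorder s x)) by rewrite /A !map_take rE.
  have BE : map snd B = toL (drop i (reorder s x)) by rewrite /B !map_drop rE.
  apply: structure_mapP => [w|].
    by rewrite inE => /orP[/eqP->|/hB//]; exact: higher_cochain_homog.
  by rewrite !map_cons BE (structure_mapP hA AE).
rewrite big_add1 /= big_mkord.
rewrite -(unsh_sum _ _ (fun i A B => if size A == i.+1 then H A B else 0)).
rewrite -[RHS](higher_cochain_jacobi charK hd); apply: eq_unsh => -[|w A] B pAB.
  rewrite big1 //; symmetry.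
  exact: (higher_nil _ (@bracket_linl K E) (@bracket_linr K E)).
have h : (size A < size x)%N.
  by rewrite -sd -(perm_size pAB) /= ltnS size_cat leq_addr.
rewrite (bigD1 (Ordinal h)) //= eqxx big1 ?addr0 // => i /eqP ni.
by rewrite eqSS; case: eqP => // e; case: ni; apply: val_inj.
Qed.
End StructureAxioms.

(** * Multilinearity and degree of the structure map *)

Section GradingAndDegree.
Variables (K : fieldType) (g V : lmodType K).
Local Notation E := (g * V)%type.
Local Notation L := (cochain E).
Local Notation M := (Lprime g V * fra g V)%type.
Local Notation proj := (@proj K g V).
Local Notation gr := (@shifted_deg K g V).
Local Notation toL := (map (@to_L K g V)).
Implicit Types (X Y : L).

Lemma foldl_bracket_linl a X X' (s : seq L) :
  foldl (@bracket K E) (a *: X + X') s =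
  a *: foldl (@bracket K E) X s + foldl (@bracket K E) X' s.
Proof. by elim: s X X' => //= y s IH X X'; rewrite bracket_linl IH. Qed.

Lemma foldl_bracket0 (s : seq L) : foldl (@bracket K E) 0 s = 0.
Proof. by elim: s => //= y s IH; rewrite (br0l (@bracket_linl K E)). Qed.

Lemma foldl_bracket_linr X a (s1 s2 : seq L) u v :
  foldl (@bracket K E) X (s1 ++ (a *: u + v) :: s2) =
  a *: foldl (@bracket K E) X (s1 ++ u :: s2)
  + foldl (@bracket K E) X (s1 ++ v :: s2).
Proof. by rewrite !foldl_cat /= bracket_linr foldl_bracket_linl. Qed.

Lemma lie_val_multilinear s1 s2 a (u v : L * L) :
  lie_val (s1 ++ (a *: u + v) :: s2) =
  a *: lie_val (s1 ++ u :: s2) + lie_val (s1 ++ v :: s2).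
Proof.
case: s1 => [|z [|z' [|z'' s1]]]; rewrite /= ?scaler0 ?addr0 //.
  case: s2 => [|z [|z' s2]]; rewrite /= ?scaler0 ?addr0 //.
  by rewrite ctwist_lin bracket_linl.
by case: s2 => [|z' s2]; rewrite /= ?scaler0 ?addr0 // bracket_linr.
Qed.

Lemma derived_val_multilinear s1 s2 a (u v : L * L) :
  derived_val (s1 ++ (a *: u + v) :: s2) =
  a *: derived_val (s1 ++ u :: s2) + derived_val (s1 ++ v :: s2).
Proof.
elim: s1 => [|z s1 IH] /=.
  rewrite foldl_bracket_linl ctwist_lin bracket_linl.
  by rewrite scalerBr opprD addrACA.
rewrite IH bracket_linr !map_cat /= foldl_bracket_linr.
by rewrite scalerBr opprD addrACA.
Qed.

Lemma structure_multilinear : multilinear (@structure_map K g V).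
Proof.
move=> s1 s2 a u v; apply: to_L_inj; rewrite to_L_lin !to_L_structure.
rewrite !map_cat !map_cons to_L_lin.
rewrite /structure_val lie_val_multilinear derived_val_multilinear.
by rewrite proj_linear.
Qed.

Lemma Lprime_deg0 (i : int) : Lprime_deg i (0 : Lprime g V).
Proof.
by rewrite /Lprime_deg; case: ifP => // _; have [] := bideg_subspace g V i 0.
Qed.

Lemma bideg_ctwist k l X : bideg k l X -> bideg k l (ctwist X).
Proof.
move=> /bidegP[dX wX]; apply/bidegP; split; last exact: weighted_twist.
by move=> x hx; rewrite /= /twist dX ?scaler0.
Qed.

Lemma cdeg_derived_val (d : nat -> int) (x : seq (L * L)) :
  (forall n, (n < size x)%N -> cdeg (d n + 1) (x`_n).1 /\ cdeg (d n) (x`_n).2) ->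
  cdeg (\sum_(n < size x) d n + 1) (derived_val x).
Proof.
have cdeg_lin i a X Y : cdeg i X -> cdeg i Y -> cdeg i (a *: X + Y).
  move=> dX dY z hz; change (a *: \val X z + \val Y z = 0).
  by rewrite dX // dY // scaler0 addr0.
have cdeg_foldl i (s : seq (L * L)) (e : nat -> int) X : cdeg i X ->
    (forall n, (n < size s)%N -> cdeg (e n) (s`_n).2) ->
    cdeg (i + \sum_(n < size s) e n) (foldl (@bracket K E) X (map snd s)).
  elim: s i e X => [|z s IH] i e X dX h /=; first by rewrite big_ord0 addr0.
  rewrite big_ord_recl addrA; apply: (IH _ (fun n => e n.+1)).
    by apply: cdeg_bracket => //; exact: (h 0%N).
  by move=> n ns; exact: (h n.+1).
elim: x d => [|z x IH] d h; first by move=> y _.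
have [dq da] := h 0%N isT; rewrite big_ord_recl /=.
have h' n : (n < size x)%N -> cdeg (d n.+1 + 1) (x`_n).1 /\ cdeg (d n.+1) (x`_n).2.
  by move=> nx; exact: (h n.+1).
rewrite [X in cdeg _ X]addrC -scaleN1r; apply: cdeg_lin.
  rewrite -addrA; apply: cdeg_bracket; last exact: (IH (fun n => d n.+1)).
  by move=> y hy; rewrite /= /twist da ?scaler0.
rewrite addrAC; apply: (cdeg_foldl _ _ (fun n => d n.+1)) => // n nx.
by have [] := h' n nx.
Qed.

Lemma structure_deg d x : homogeneous gr d x ->
  gr (\sum_(i < size x) d i + 1) (structure_map x).
Proof.
move=> hx; split; last first.
  rewrite /fra_deg /=.
  have dD : cdeg (\sum_(i < size x) d i + 1) (derived_val (toL x)).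
    have := @cdeg_derived_val d (toL x); rewrite size_map; apply=> n nx.
    have [hq ha] := hx n nx; rewrite (nth_map 0) //.
    by have [da _] := fra_deg_cdeg ha; split=> //; exact: Lprime_deg_cdeg.
  by have := proj_deg dD; case: ifP => // _ e; apply: val_inj.
have lie0 : lie_val (toL x) = 0 ->
    Lprime_deg (\sum_(i < size x) d i + 1 + 1) (structure_map x).1.
  move=> e; have -> : (structure_map x).1 = 0 by apply: val_inj.
  exact: Lprime_deg0.
case: x hx lie0 => [|z [|z' [|z'' x]]] hx lie0; try exact: lie0.
have [hq _] := hx 0%N isT; have [hq' _] := hx 1%N isT; rewrite /= in hq hq'.
rewrite /Lprime_deg in hq hq'.
have [i0|i0] := boolP (0 <= d 0%N + 1); last first.
  apply: lie0; rewrite (negPf i0) in hq.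
  by rewrite /= hq ctwist0 (br0l (@bracket_linl K E)).
have [i1|i1] := boolP (0 <= d 1%N + 1); last first.
  apply: lie0; rewrite (negPf i1) in hq'.
  by rewrite /= hq' (br0r (@bracket_linr K E)).
rewrite i0 in hq; rewrite i1 in hq'.
rewrite /Lprime_deg /= !big_ord_recl big_ord0 /= /bump /= addr0.
have -> : d 0%N + d 1%N + 1 + 1 = d 0%N + 1 + (d 1%N + 1) by lia.
have -> : 0 <= d 0%N + 1 + (d 1%N + 1) by lia.
by have := bideg_bracket (bideg_ctwist hq) hq'; rewrite addr0.
Qed.
End GradingAndDegree.

(** * The grading and the remaining structure maps *)

Section Grading.
Variables (K : fieldType) (g V : lmodType K).
Local Notation E := (g * V)%type.
Local Notation L := (cochain E).
Local Notation M := (Lprime g V * fra g V)%type.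
Local Notation proj := (@proj K g V).
Local Notation gr := (@shifted_deg K g V).
Implicit Types (X Y : L).

(** Components of different degrees are supported on different arities. The shift [s] is 1 for L'[1]
    and 0 for a. *)
Lemma cdeg_independent (s : int) (r : seq int) (F : int -> L) :
  uniq r -> (forall i, cdeg (i + s) (F i)) -> \sum_(i <- r) F i = 0 ->
  forall i, i \in r -> F i = 0.
Proof.
move=> ur dF F0 i ir; apply: cochain_eq => x.
have [e|ne] := eqVneq (size x)%:Z (i + s + 1); last first.
  by rewrite dF //; apply/eqP.
have valS (t : seq int) : \val (\sum_(j <- t) F j) x = \sum_(j <- t) \val (F j) x.
  by elim: t => [|j t IH]; rewrite ?big_nil // !big_cons -IH.
have := congr1 (fun X => \val X x) F0.
rewrite valS (bigD1_seq i) //= big1 ?addr0 // => j ji.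
by apply: dF => e'; case/eqP: ji; lia.
Qed.

Lemma fra_proj (a : fra g V) : proj (\val a) = \val a.
Proof.
have [N [c [hc ->]]] := subP a; rewrite linear_sum.
by apply: eq_bigr => i _; exact: proj_bideg_a.
Qed.

Lemma Lprime_proj (q : Lprime g V) : proj (\val q) = 0.
Proof.
have [N [c [hc ->]]] := subP q; rewrite linear_sum big1 // => i _.
exact: (proj_bideg _ (hc i)).
Qed.

Lemma Lprime_trunc (q : Lprime g V) n : Lprime_space g V (trunc n (\val q)).
Proof. by apply/LprimeP/weighted_trunc/LprimeP; exact: subP. Qed.

Lemma shifted_degE i (z : M) : gr i z <->
  (if 0 <= i + 1 then bideg (i + 1) 0 (to_L z).1 else (to_L z).1 = 0) /\
  (if 0 <= i then bideg (-1) (i + 1) (to_L z).2 else (to_L z).2 = 0).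
Proof.
rewrite /shifted_deg /Lprime_deg /fra_deg.
by split=> -[]; case: ifP => _ h; case: ifP => _ h'; split=> //;
  try (apply: val_inj; assumption); rewrite /= ?h ?h'.
Qed.

Lemma shifted_deg_subspace i : is_subspace (gr i).
Proof.
have [L0 LD] := bideg_subspace g V (i + 1) 0.
have [a0 aD] := bideg_subspace g V (-1) (i + 1).
split; first by apply/shifted_degE; split; case: ifP.
move=> c u v /shifted_degE[uq ua] /shifted_degE[vq va].
apply/shifted_degE; rewrite to_L_lin.
move: (to_L u) (to_L v) uq ua vq va => {u v} [X a] [X' a'] /= uq ua vq va; split.
  move: uq vq; case: ifP => _; first exact: LD.
  by move=> -> ->; rewrite scaler0 addr0.
move: ua va; case: ifP => _; first exact: aD.
by move=> -> ->; rewrite scaler0 addr0.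
Qed.

Lemma shifted_deg_grading : is_grading gr.
Proof.
split; first exact: shifted_deg_subspace.
  case=> q a; have [N1 qE] := sum_trunc (\val q).
  have [N2 aE] := sum_trunc (\val a).
  pose cq (i : int) : Lprime g V :=
    if i is Posz n then mk_sub (Lprime_trunc q n) else 0.
  pose ca (i : int) : fra g V :=
    if i is Posz n then mk_sub (proj_in_a (trunc n (\val a))) else 0.
  pose N := maxn N1 N2.
  (* Degrees start at -1, because L'[1] has C^{0|0} there; a starts at 0, so its first component in
     this list is 0. *)
  exists [seq n%:Z - 1 | n <- iota 0 N.+1], (fun i => (cq (i + 1), ca i)); split.
    move=> i; split; rewrite /=.
      rewrite /Lprime_deg; case: (i + 1) => n //=.
      apply/bidegP; split; first by rewrite addr0; exact: cdeg_trunc.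
      by apply/weighted_trunc/LprimeP; exact: subP.
    rewrite /fra_deg; case: i => n //=.
    by have := proj_deg (@cdeg_trunc K g V n (\val a)).
  apply: to_L_inj; rewrite to_L_sum big_map.
  have sum_pair (r : seq nat) (F F' : nat -> L) :
      \sum_(n <- r) (F n, F' n) = (\sum_(n <- r) F n, \sum_(n <- r) F' n) :> L * L.
    by elim: r => [|n r IH]; rewrite ?big_nil // !big_cons IH.
  rewrite (sum_pair _ (fun n => \val (cq (n%:Z - 1 + 1)))
    (fun n => \val (ca (n%:Z - 1)))).
  rewrite -/(index_iota 0 N.+1) !big_mkord; congr pair.
    rewrite /= [LHS](qE N.+1); last by rewrite leqW // leq_maxl.
    by apply: eq_bigr => n _; rewrite subrK.
  have ca0 : \val (ca (0%:Z - 1)) = 0 by [].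
  have caS n : \val (ca (n.+1%:Z - 1)) = proj (trunc n (\val a)).
    by have -> : n.+1%:Z - 1 = n%:Z by lia.
  rewrite big_ord_recl ca0 add0r -[LHS]fra_proj [X in proj X](aE N) ?leq_maxr //.
  by rewrite linear_sum; apply: eq_bigr => n _; exact: (esym (caS n)).
move=> r c ur hc c0 i ir.
have cL : \sum_(j <- r) to_L (c j) = 0 by rewrite -to_L_sum c0.
have c1 : \sum_(j <- r) (to_L (c j)).1 = 0.
  rewrite -[RHS](congr1 fst cL).
  by elim: (r) => [|j t IH]; rewrite ?big_nil // !big_cons IH.
have c2 : \sum_(j <- r) (to_L (c j)).2 = 0.
  rewrite -[RHS](congr1 snd cL).
  by elim: (r) => [|j t IH]; rewrite ?big_nil // !big_cons IH.
apply: to_L_inj; rewrite [LHS]surjective_pairing; congr pair.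
  apply: (@cdeg_independent 1 r (fun j => (to_L (c j)).1) ur _ c1 i ir) => j.
  by have [h _] := hc j; exact: Lprime_deg_cdeg.
apply: (@cdeg_independent 0 r (fun j => (to_L (c j)).2) ur _ c2 i ir) => j.
by have [_ h] := hc j; rewrite addr0; have [] := fra_deg_cdeg h.
Qed.

(** Without an entry from L' every iterated bracket starts at 0; with two of them, one is bracketed
    in through its component in a, which is 0. *)
Lemma derived_val_inl (t : seq (Lprime g V + fra g V)) :
  count (fun y => is_inl y) t <> 1%N ->
  derived_val [seq to_L (sum_inj y) | y <- t] = 0.
Proof.
elim: t => [|[q|a] t IH] //= ht; last first.
  by rewrite foldl_bracket0 IH // (br0r (@bracket_linr K E)) subr0.
rewrite ctwist0 (br0l (@bracket_linl K E)) subr0.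
have : has (fun y => is_inl y) t.
  by rewrite has_count lt0n; apply: contra_notN ht => /eqP->.
case/split_find=> y t1 t2 + _; case: y => // q' _.
rewrite -cats1 -catA !map_cat /= foldl_cat /=.
by rewrite (br0r (@bracket_linr K E)) foldl_bracket0.
Qed.

(** A bracket with an element of C^{-1|n+1} lowers k by 1 and raises l by n + 1, so l stays
    nonnegative, as [projection_bideg] requires. *)
Lemma foldl_bideg k l X (a : seq (fra g V)) : 0 <= l -> bideg k l X ->
  (forall b, b \in a -> exists n : nat, fra_deg n b) ->
  exists k' l', 0 <= l' /\
    bideg k' l' (foldl (@bracket K E) X [seq \val b | b <- a]).
Proof.
elim: a k l X => [|b a IH] k l X l0 hX ha; first by exists k, l.
have [n hb] := ha b (mem_head _ _).
apply: (IH (k - 1) (l + (n%:Z + 1))); first by lia.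
  exact: bideg_bracket.
by move=> b' hb'; apply: ha; rewrite inE hb' orbT.
Qed.
End Grading.

Theorem theorem3p11 (K : fieldType) (charK : [pchar K] =i pred0)
    (g V : lmodType K)
    (P : {linear cochain (g * V)%type -> cochain (g * V)%type})
    (hP : is_projection_on_a P) :
  exists l : seq (Lprime g V * fra g V) -> Lprime g V * fra g V,
    [/\ Linfty_algebra (@shifted_deg K g V) l,
        forall (m n : nat) (q q' : Lprime g V),
          Lprime_deg m q -> Lprime_deg n q' ->
          to_L (l [:: (q, 0); (q', 0)]) =
            ((-1) ^+ m *: bracket (\val q) (\val q'), 0),
        forall (m : nat) (q : Lprime g V) (a : seq (fra g V)),
          Lprime_deg m q ->
          (forall b, b \in a -> exists n : nat, fra_deg n b) ->
          (0 < size a)%N ->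
          to_L (l ((q, 0) :: [seq (0, b) | b <- a])) =
            (0, P (foldl (@bracket K (g * V)%type) (\val q)
                     [seq \val b | b <- a]))
      & forall t : seq (Lprime g V + fra g V),
          (0 < size t)%N ->
          ~ (size t = 2%N /\ count (fun y => is_inl y) t = 2%N) ->
          ~ ((2 <= size t)%N /\ count (fun y => is_inl y) t = 1%N) ->
          l [seq sum_inj y | y <- t] = 0].
Proof.
have b0l := br0l (@bracket_linl K (g * V)%type).
have b0r := br0r (@bracket_linr K (g * V)%type).
exists (@structure_map K g V); split.
- split.
  + exact: shifted_deg_grading.
  + exact: structure_multilinear.
  + by move=> d x _; exact: structure_deg.
  + by move=> d x s; exact: structure_sym.
  + by move=> d x _; exact: structure_jacobi.
- move=> m n q q' hq hq'; rewrite to_L_structure /structure_val /=.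
  rewrite (ctwistE (cdeg_cpar (Lprime_deg_cdeg hq))) absz_nat signr_odd.
  by rewrite (brZl (@bracket_linl K _)) b0r ctwist0 b0l subr0 linear0.
- move=> m q a hq ha a0; rewrite to_L_structure /structure_val /=.
  rewrite ctwist0 b0l subr0 -!map_comp; congr pair.
    by case: (a) => [|b [|b' a']] //=; rewrite b0r.
  have [k [l [l0 hX]]] := @foldl_bideg K g V m 0 (\val q) a isT hq ha.
  by rewrite (projection_bideg hP l0 hX).
- move=> t t0 n1 n2; apply: to_L_inj; rewrite to_L_structure -map_comp.
  congr pair.
    case: t t0 n1 n2 => [|[q|a] [|[q'|a'] [|y'' t]]] //= _ n1 n2.
    + by case: n1.
    + by rewrite b0r.
    + by rewrite ctwist0 b0l.
    + by rewrite ctwist0 b0l.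
  have [c1|c1] := eqVneq (count (fun y => is_inl y) t) 1%N; last first.
    by rewrite derived_val_inl ?linear0 //; exact/eqP.
  case: t t0 n1 n2 c1 => [|[q|a] [|y t]] //= _ n1 n2 c1; try by case: n2.
  (* The only remaining sequence is a single q[1]: there the component in a is the projection of q,
     and L' lies in the kernel of [proj]. *)
  by rewrite ctwist0 b0l subr0; exact: Lprime_proj.
Qed.
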